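(* Consider the uplink system with $M$ base station antennas and $K$ users and additive hardware distortion described in the context, with LMMSE channel estimates $\hat{\mathbf{h}}_k=\mathbf{R}_k\boldsymbol{\Psi}_k^{-1}\mathbf{z}_k$. If maximum ratio combining $\mathbf{v}_k=\hat{\mathbf{h}}_k$ is used, then for every $k\in\{1,\dots,K\}$ the effective SINR $$\mathrm{SINR}_k=\frac{\left|\mathbb{E}\{\mathbf{v}_k^H\mathbf{h}_k\}\right|^2\rho_k}{\sum_{i=1}^{K}\mathbb{E}\{|\mathbf{v}_k^H\mathbf{h}_i|^2\}\rho_i-\left|\mathbb{E}\{\mathbf{v}_k^H\mathbf{h}_k\}\right|^2\rho_k+\mathbb{E}\{|\mathbf{v}_k^H\mathbf{n}|^2\}+\mathbb{E}\{|\mathbf{v}_k^H\mathbf{e}|^2\}}$$ (where $\mathbf{n},\mathbf{e}$ are the data-phase noise and distortion) equals $$\overline{\mathrm{SINR}}_k=\frac{\rho_k\left(\mathrm{tr}\left(\mathbf{R}_k\boldsymbol{\Psi}_k^{-1}\mathbf{R}_k\right)\right)^2}{S_k+T_k+U_k},$$ where $$S_k=\rho_k\,\mathrm{tr}\Big(\mathbf{D}_{\epsilon}^2\,\mathrm{abs}\big(\mathrm{diag}(\mathbf{R}_k\boldsymbol{\Psi}_k^{-1}\mathbf{R}_k)\big)^2\Big),$$ $$T_k=\sum_{i=1}^{K}\frac{\rho_i\varrho_i}{\tau_p\varrho_k}\,\mathrm{tr}\Big(\mathbf{D}_{\epsilon}^2\,\mathrm{abs}\big(\mathrm{diag}(\mathbf{R}_i\mathbf{R}_k\boldsymbol{\Psi}_k^{-1})\big)^2+\mathbf{D}_{\epsilon}^2\,\mathrm{diag}\big(\mathrm{abs}(\mathbf{R}_k\boldsymbol{\Psi}_k^{-1})^2\,\mathbf{D}_{\epsilon}^2\,\mathrm{abs}(\mathbf{R}_i)^2\big)\Big),$$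 $$U_k=\mathrm{tr}\Big(\Big(\sum_{i=1}^{K}\rho_i\mathbf{R}_i+\sigma^2\mathbf{I}_M+\sum_{i=1}^{K}\rho_i\mathbf{D}_{\epsilon}^2\mathbf{D}_{\mathbf{R}_i}\Big)\mathbf{R}_k\boldsymbol{\Psi}_k^{-1}\mathbf{R}_k\Big).$$
   Context: Notation. For a matrix $\mathbf{X}$: $\mathrm{diag}(\mathbf{X})$ is $\mathbf{X}$ with all off-diagonal entries set to zero; $\mathrm{abs}(\mathbf{X})^2$ is the matrix whose entries are the squared absolute values of the entries of $\mathbf{X}$. $\mathbf{D}_\epsilon=\mathrm{diag}(\epsilon_1,\dots,\epsilon_M)$ with constants $\epsilon_m\ge 0$; $\mathbf{D}_{\mathbf{R}_i}=\mathrm{diag}(\mathbf{R}_i)$; $\mathbf{D}_{h_i}=\mathrm{diag}(|[\mathbf{h}_i]_1|^2,\dots,|[\mathbf{h}_i]_M|^2)$. Channels. $\mathbf{h}_1,\dots,\mathbf{h}_K\in\mathbb{C}^M$ are mutually independent, $\mathbf{h}_k\sim\mathcal{CN}(\mathbf{0},\mathbf{R}_k)$, with $\mathbf{R}_k$ Hermitian positive semidefinite and nonzero. Pilot phase. With $\tau_p$ pilot samples and pilot symbol energies $\varrho_i>0$, the channel observation for user $k$ is $$\mathbf{z}_k=\mathbf{h}_k+\frac{1}{\sqrt{\tau_p\varrho_k}}\Big(\bar{\mathbf{n}}+\mathbf{D}_\epsilon\Big(\sum_{i=1}^K\varrho_i\mathbf{D}_{h_i}\Big)^{1/2}\bar{\mathbf{r}}\Big),$$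 with $\bar{\mathbf{n}}\sim\mathcal{CN}(\mathbf{0},\sigma^2\mathbf{I}_M)$, $\sigma^2>0$, $\bar{\mathbf{r}}\sim\mathcal{CN}(\mathbf{0},\mathbf{I}_M)$. The LMMSE channel estimate of $\mathbf{h}_k$ is $\hat{\mathbf{h}}_k=\mathbf{R}_k\boldsymbol{\Psi}_k^{-1}\mathbf{z}_k$ with $$\boldsymbol{\Psi}_k=\mathbf{R}_k+\frac{1}{\tau_p\varrho_k}\Big(\sigma^2\mathbf{I}_M+\sum_{i=1}^{K}\varrho_i\mathbf{D}_\epsilon\mathbf{D}_{\mathbf{R}_i}\mathbf{D}_\epsilon\Big).$$ Data phase. With data symbol energies $\rho_i\ge0$, the data-phase noise is $\mathbf{n}\sim\mathcal{CN}(\mathbf{0},\sigma^2\mathbf{I}_M)$ and the data-phase hardware distortion is $\mathbf{e}=\mathbf{D}_\epsilon\big(\sum_{i=1}^K\rho_i\mathbf{D}_{h_i}\big)^{1/2}\mathbf{r}$ with $\mathbf{r}\sim\mathcal{CN}(\mathbf{0},\mathbf{I}_M)$. The vectors $\bar{\mathbf{n}},\bar{\mathbf{r}},\mathbf{n},\mathbf{r}$ are mutually independent and independent of all channels. (The quantity $(1-\tau_p/\tau_c)\log_2(1+\mathrm{SINR}_k)$, with $\tau_c$ the number of samples per coherence block, is an achievable spectral efficiency of user $k$, i.e. a lower bound on its ergodic capacity.) *)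

(* Defs.v *)
From HB Require Import structures.
From mathcomp Require Import all_boot all_order all_algebra.
From mathcomp Require Import complex.
From mathcomp Require Import all_classical all_reals all_analysis.

Set Implicit Arguments.
Unset Strict Implicit.
Unset Printing Implicit Defensive.

Import Order.TTheory GRing.Theory Num.Theory.
Import numFieldNormedType.Exports.

Local Open Scope classical_set_scope.
Local Open Scope ring_scope.
Local Open Scope complex_scope.
Local Open Scope sesquilinear_scope.

Section Matrices.
Context {R : realType} {M : nat}.
Implicit Types (X A : 'M[R[i]]_M).

Definition diagpart X : 'M[R[i]]_M := diag_mx (\row_m X m m).

Definition abs2mx X : 'M[R[i]]_M := \matrix_(m, l) (`|X m l| ^+ 2).

(* In R[i], [0 <= z] means that z is real and nonnegative. *)
Definition hermitian_psd A : Prop :=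
  A \is hermsymmx /\ forall x : 'cV[R[i]]_M, 0 <= (x^t* *m A *m x) 0 0.

End Matrices.

(* The inner product v^H x. *)
Definition hdot {R : realType} {M : nat} (v x : 'cV[R[i]]_M) : R[i] :=
  (v^t* *m x) 0 0.

Section RandomVectors.
Context {d : measure_display} {T : measurableType d} {R : realType}.
Variable P : probability T R.

Definition cexpectation (X : T -> R[i]) : R[i] :=
  fine 'E_P[fun w => complex.Re (X w)] +i* fine 'E_P[fun w => complex.Im (X w)].

(* Expectation of a squared modulus, as a real number. *)
Definition second_moment (X : T -> R[i]) : R :=
  fine 'E_P[fun w => Normc.normc (X w) ^+ 2].

(* The centered real normal law with variance v.  The case v = 0 is separate
   because [normal_prob m 0] is not the Dirac mass at m. *)
Definition centered_normal (v : R) (A : set (measurableTypeR R)) : \bar R :=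
  if v == 0 then dirac (0 : measurableTypeR R) A
  else normal_prob 0 (Num.sqrt v) A.

(* CN(0, S): a random vector X with every real linear functional Re (t^H X)
   normal, of mean 0 and variance t^H S t / 2.  These laws determine the law
   of X, and S may be singular. *)
Definition is_CN {M : nat} (S : 'M[R[i]]_M) (X : T -> 'cV[R[i]]_M) : Prop :=
  (forall m, measurable_fun setT (fun w => complex.Re (X w m 0)) /\
             measurable_fun setT (fun w => complex.Im (X w m 0))) /\
  forall (t : 'cV[R[i]]_M) (A : set (measurableTypeR R)), measurable A ->
    P ((fun w => complex.Re (hdot t (X w))) @^-1` A) =
    centered_normal (complex.Re (hdot t (S *m t)) / 2) A.

(* The sigma-algebra generated by a complex random vector. *)
Definition sigma_of {M : nat} (X : T -> 'cV[R[i]]_M) : set (set T) :=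
  <<s [set E | exists m (A : set (measurableTypeR R)), measurable A /\
        (E = (fun w => complex.Re (X w m 0)) @^-1` A \/
         E = (fun w => complex.Im (X w m 0)) @^-1` A)] >>.

Definition mutually_independent {I : finType} {M : nat}
    (X : I -> T -> 'cV[R[i]]_M) : Prop :=
  forall (J : {set I}) (E : I -> set T),
    (forall j, j \in J -> sigma_of (X j) (E j)) ->
    P (\bigcap_(j in [set` J]) E j) = (\prod_(j in J) P (E j))%E.

End RandomVectors.

(* tau: number of pilot samples; pil and rho: pilot and data symbol energies;
   sigma2: noise variance; eps: hardware distortion coefficients; Rc: channel
   covariance matrices. *)
Section Uplink.
Context {R : realType} {M K : nat}.
Variables (tau : nat) (pil rho : 'I_K -> R) (sigma2 : R) (eps : 'I_M -> R).
Variable Rc : 'I_K -> 'M[R[i]]_M.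

Definition Deps : 'M[R[i]]_M := diag_mx (\row_m (eps m)%:C).

Definition Dchan (g : 'cV[R[i]]_M) : 'M[R[i]]_M :=
  diag_mx (\row_m (`|g m 0| ^+ 2)).

(* D_eps (sum_i p_i D_{g_i})^{1/2} s.  The matrix under the root is diagonal
   with nonnegative entries, so its square root is the entrywise one. *)
Definition distortion (p : 'I_K -> R) (g : 'I_K -> 'cV[R[i]]_M)
    (s : 'cV[R[i]]_M) : 'cV[R[i]]_M :=
  Deps *m map_mx sqrtC (\sum_i (p i)%:C *: Dchan (g i)) *m s.

Definition pilot_obs (g : 'I_K -> 'cV[R[i]]_M) (nbar rbar : 'cV[R[i]]_M)
    (k : 'I_K) : 'cV[R[i]]_M :=
  g k + ((Num.sqrt (tau%:R * pil k))^-1)%:C *: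
        (nbar + distortion pil g rbar).

Definition Psi (k : 'I_K) : 'M[R[i]]_M :=
  Rc k + ((tau%:R * pil k)^-1)%:C *:
    (sigma2%:C%:M
     + \sum_(i < K) (pil i)%:C *: (Deps *m diagpart (Rc i) *m Deps)).

Definition lmmse (k : 'I_K) (z : 'cV[R[i]]_M) : 'cV[R[i]]_M :=
  Rc k *m invmx (Psi k) *m z.

Definition S_term (k : 'I_K) : R[i] :=
  (rho k)%:C *
  \tr (Deps ^+ 2 *m abs2mx (diagpart (Rc k *m invmx (Psi k) *m Rc k))).

Definition T_term (k : 'I_K) : R[i] :=
  \sum_(i < K) (rho i * pil i / (tau%:R * pil k))%:C *
    \tr (Deps ^+ 2 *m abs2mx (diagpart (Rc i *m Rc k *m invmx (Psi k)))
         + Deps ^+ 2 *m diagpart (abs2mx (Rc k *m invmx (Psi k))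
                                  *m Deps ^+ 2 *m abs2mx (Rc i))).

Definition U_term (k : 'I_K) : R[i] :=
  \tr ((\sum_(i < K) (rho i)%:C *: Rc i + sigma2%:C%:M
        + \sum_(i < K) (rho i)%:C *: (Deps ^+ 2 *m diagpart (Rc i)))
       *m (Rc k *m invmx (Psi k) *m Rc k)).

Definition SINR_mrc (k : 'I_K) : R[i] :=
  (rho k)%:C * (\tr (Rc k *m invmx (Psi k) *m Rc k)) ^+ 2
  / (S_term k + T_term k + U_term k).

End Uplink.

(* Effective SINR of user k for the combining vector v, with data-phase noise n
   and distortion e. *)
Definition SINR {d : measure_display} {T : measurableType d} {R : realType}
    (P : probability T R) {M K : nat} (rho : 'I_K -> R)
    (h : 'I_K -> T -> 'cV[R[i]]_M) (n e v : T -> 'cV[R[i]]_M) (k : 'I_K) : R :=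
  let signal := Normc.normc
                  (cexpectation P (fun w => hdot (v w) (h k w))) ^+ 2 * rho k in
  signal /
  (\sum_(i < K) second_moment P (fun w => hdot (v w) (h i w)) * rho i
   - signal
   + second_moment P (fun w => hdot (v w) (n w))
   + second_moment P (fun w => hdot (v w) (e w))).

(* The family (h_1, ..., h_K, nbar, rbar, n, r). *)
Definition sources {T : Type} {R : realType} {M K : nat}
    (h : 'I_K -> T -> 'cV[R[i]]_M) (nbar rbar n r : T -> 'cV[R[i]]_M)
    (s : 'I_K + 'I_4) : T -> 'cV[R[i]]_M :=
  match s with
  | inl i => h i
  | inr j => nth nbar [:: nbar; rbar; n; r] j
  end.

(* Main.v *)
(** Every expectation in the SINR is computed by stripping off one independent
    source at a time. A noise vector X independent of a and of the W_m
    contributes only the diagonal term v * sum_m E|W_m|^2 to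
    E|a + sum_m W_m X_m|^2, and this holds even though the weights of the pilot
    distortion involve square roots of the channels: only their squares remain.
    What is left are second and fourth moments of the channels. The fourth
    moments follow from E Y^4 = 3 v^2 for the real normal law of each functional
    Re (u X), by polarization of a quartic form. The products of second moments
    assemble into Psi_k, which cancels against its inverse, and the remaining
    Gaussian pairings give |E v^H h_k|^2, S_k and T_k. *)

From HB Require Import structures.
Require Import Defs.
From mathcomp Require Import all_boot all_order all_algebra.
From mathcomp Require Import complex.
From mathcomp Require Import all_classical all_reals all_analysis.
From mathcomp Require Import measurable_realfun.
From mathcomp Require Import ring lra.

Set Implicit Arguments.
Unset Strict Implicit.
Unset Printing Implicit Defensive.

Import Order.TTheory GRing.Theory Num.Theory.
Import numFieldNormedType.Exports.

Local Open Scope classical_set_scope.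
Local Open Scope complex_scope.
Local Open Scope sesquilinear_scope.
Local Open Scope ring_scope.

(** The hypothesis [is_CN] gives only the laws of the real functionals Re (u X). The diagonal
    moments E|u X|^2 and E|u X|^4 can be computed from it directly; the mixed ones have to be
    recovered through sesquilinearity. Independence is used between sigma-algebras, because the
    distortion amplitudes are nonlinear functions of all channels and must still factor away from a
    noise coordinate. Integrability is tracked in L^4, since an energy squares a product of two
    factors.

    The distortions are uncorrelated with the channels but not independent of them, and [Psi k]
    records only the mean power of the pilot distortion. Correlations of instantaneous powers
    account for the extra terms. S_k pairs h_k inside the estimate with its own share of the data
    distortion power. The first half of T_k pairs the pilot distortion power caused by user i with
    h_i in v^H h_i; the second half pairs the pilot and data distortion powers caused by the same
    user. For i = k, E|v^H h_i|^2 also contains |E v^H h_k|^2, which, weighted by rho_k, is the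
    signal term subtracted in the denominator. *)

Local Notation "\Re z" := (complex.Re z) (at level 10, z at level 8).
Local Notation "\Im z" := (complex.Im z) (at level 10, z at level 8).
Local Notation normc := Normc.normc.

(** * Even moments of the normal law *)

Section NormalMoments.
Context {R : realType}.
Notation mu := (@lebesgue_measure R).

(** The Radon-Nikodym derivative of the law and [normal_pdf] have the same integral over every
    measurable set, so they agree almost everywhere, and the change of variables known for the
    former transfers to the latter. *)
Lemma ge0_integral_normal_prob (m s : R) (f : measurableTypeR R -> \bar R) :
  measurable_fun setT f -> (forall x, (0 <= f x)%E) ->
  (\int[normal_prob m s]_x f x =
   \int[mu]_x (f x * (normal_pdf m s x)%:E))%E.
Proof.
move=> mf f0.
have dom := normal_prob_dominates m s.
rewrite -(Radon_Nikodym_SigmaFinite.change_of_variables dom)//.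
apply: ae_eq_integral => //.
- apply: emeasurable_funM => //.
  exact: measurable_int (Radon_Nikodym_SigmaFinite.f_integrable dom).
- apply: emeasurable_funM => //.
  by apply/measurable_EFinP; exact: measurable_normal_pdf.
- apply: ae_eqe_mul2l; apply: integral_ae_eq => //.
  + exact: Radon_Nikodym_SigmaFinite.f_integrable.
  + by apply/measurable_EFinP; exact: measurable_normal_pdf.
  + by move=> E _ mE; rewrite -(Radon_Nikodym_SigmaFinite.f_integral dom).
Qed.

Variable s : R.
Hypothesis s_gt0 : 0 < s.
Let s_neq0 : s != 0. Proof. by rewrite gt_eqF. Qed.

Let pdf := normal_pdf 0 s.

Let pdfE x : pdf x = normal_peak s * expR (- x ^+ 2 / (s ^+ 2 *+ 2)).
Proof. by rewrite /pdf normal_pdfE// /normal_fun subr0. Qed.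

Let is_derive_pdf x : is_derive x (1 : R) pdf (- (x / s ^+ 2) * pdf x).
Proof.
have -> : pdf = (fun x => normal_peak s * expR (- x ^+ 2 / (s ^+ 2 *+ 2))).
  by apply/funext => y; exact: pdfE.
apply: is_derive_eq; rewrite /GRing.scale/=.
by field.
Qed.

Let cpdf : continuous pdf. Proof. exact: continuous_normal_pdf. Qed.

Let cXpdf k : continuous (fun x : R => x ^+ k * pdf x).
Proof. by move=> x; apply: cvgM; [exact: exprn_continuous|exact: cpdf]. Qed.

Let tail_cvg k : (k <= 3)%N ->
  (n%:R : R) ^+ k * pdf n%:R @[n --> \oo] --> (0 : R).
Proof.
(* Passing to [n.+1] gives [1 <= x], so that every power up to the third is bounded by [x ^+ 3], and
   matches the denominator of [harmonic]. *)
move=> k3; rewrite -cvg_shiftS/=.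
(* With [y = x ^+ 2 / (2 * s ^+ 2)], the bound [y ^+ 2 / 2 <= expR y] gives x^3 exp(-y) <= 8 s^4 /
   x, whence the constant. *)
pose C := normal_peak s * (8 * s ^+ 4).
apply: (@squeeze_cvgr _ _ _ _ (cst 0) (fun n => C * harmonic n)); last 2 first.
- exact: cvg_cst.
- by rewrite -[X in _ --> X](mulr0 C); apply: cvgMr; exact: cvg_harmonic.
near=> n.
have n1 : 1 <= n.+1%:R :> R by rewrite ler1n.
set x : R := n.+1%:R in n1 *.
have x0 : 0 < x by exact: lt_le_trans n1.
have pk0 : 0 < normal_peak s := normal_peak_gt0 s_neq0.
rewrite pdfE -/x; apply/andP; split.
  by rewrite !mulr_ge0 ?exprn_ge0 ?expR_ge0 ?normal_peak_ge0 ?(ltW x0).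
set y := x ^+ 2 / (s ^+ 2 *+ 2).
rewrite mulNr expRN.
have y0 : 0 < y by rewrite divr_gt0 ?exprn_gt0// pmulrn_lgt0// exprn_gt0.
have ey : y ^+ 2 / 2 <= expR y.
  apply: le_trans (expR_ge1Dxn 1 (ltW y0)).
  by rewrite !factS fact0 !muln1 ler_wpDl.
apply: (@le_trans _ _ (x ^+ 3 * (normal_peak s * (y ^+ 2 / 2)^-1))).
  apply: ler_pM.
  - by rewrite exprn_ge0 ?(ltW x0).
  - by rewrite mulr_ge0 ?invr_ge0 ?expR_ge0 ?(ltW pk0).
  - exact: ler_weXn2l.
  - by rewrite ler_pM2l// lef_pV2 ?posrE ?expR_gt0 ?divr_gt0 ?exprn_gt0.
rewrite le_eqVlt; apply/orP; left; apply/eqP.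
rewrite /C /harmonic/= /y -/x; field.
by rewrite s_neq0 gt_eqF.
Unshelve. all: by end_near. Qed.

(** Integration by parts: [s ^+ 2 * F] has derivative [c * h - g]. It is done on the segments from 0
    to n; the boundary term vanishes in the limit by [tail_cvg], and the integrals converge
    monotonically because evenness of [k] makes [g] and [h] nonnegative. *)
Let half_moment k : (k <= 2)%N -> ~~ odd k ->
  (\int[mu]_(x in `[0%R, +oo[) (x ^+ k.+2 * pdf x)%:E =
   (s ^+ 2 * k.+1%:R)%:E * \int[mu]_(x in `[0%R, +oo[) (x ^+ k * pdf x)%:E)%E.
Proof.
move=> k2 ek.
pose F x := x ^+ k.+1 * pdf x.
pose g x := x ^+ k.+2 * pdf x.
pose h x := x ^+ k * pdf x.
pose c := s ^+ 2 * k.+1%:R.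
have dF x : is_derive x (1 : R) F (k.+1%:R * h x - g x / s ^+ 2).
  have Dp := is_derive_pdf x.
  have -> : F = (@idfun R ^+ k.+1) * pdf.
    by apply/funext => y; rewrite /F fctE exprfctE.
  apply: is_derive_eq; rewrite exprfctE /h /g /GRing.scale/= !exprS.
  rewrite -[_ *+ k.+1]mulr_natl; field.
  by rewrite s_neq0.
have g0 x : 0 <= g x.
  by rewrite mulr_ge0 ?exprn_even_ge0 ?normal_pdf_ge0//= negbK.
have h0 x : 0 <= h x.
  by rewrite mulr_ge0 ?exprn_even_ge0 ?normal_pdf_ge0.
have ck (f : R -> R) (n : nat) : continuous f ->
    mu.-integrable `[0%R, n%:R] (EFin \o f).
  move=> cf; apply: continuous_compact_integrable; first exact: segment_compact.
  exact: continuous_subspaceT.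
have cg : continuous g by exact: cXpdf.
have ch : continuous h by exact: cXpdf.
have step n : (\int[mu]_(x in `[0%R, n%:R]) (g x)%:E =
    c%:E * \int[mu]_(x in `[0%R, n%:R]) (h x)%:E - (s ^+ 2 * F n%:R)%:E)%E.
  (* The fundamental theorem of calculus is applied on a nondegenerate segment, so [n = 0] is
     settled by hand. *)
  have [->|n0] := posnP n.
    rewrite set_itv1 !integral_set1 mule0 /F expr0n/=.
    by rewrite mul0r mulr0 oppr0 adde0.
  have n0' : 0 < n%:R :> R by rewrite ltr0n.
  pose f x := c * h x - g x.
  have cf : continuous f.
    move=> x; apply: cvgB; last exact: cg.
    by apply: cvgM; [exact: cvg_cst|exact: ch].
  have : (\int[mu]_(x in `[0%R, n%:R]) (f x)%:E =
      (s ^+ 2 * F n%:R)%:E - (s ^+ 2 * F 0)%:E)%E.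
    have dsF x : is_derive x (1 : R) (fun x => s ^+ 2 * F x) (f x).
      apply: is_derive_eq; rewrite /f /c /GRing.scale/=; field.
      by rewrite s_neq0.
    apply: (@continuous_FTC2 _ _ (fun x => s ^+ 2 * F x)) => //.
    - exact: continuous_subspaceT.
    - have cF : continuous (fun x => s ^+ 2 * F x).
        move=> x; apply: cvgM; first exact: cvg_cst.
        exact: cXpdf.
      split.
      + by move=> x _; exact: ex_derive.
      + by apply: cvg_at_right_filter; exact: cF.
      + by apply: cvg_at_left_filter; exact: cF.
    - by move=> x _; rewrite derive1E; exact: derive_val.
  rewrite /F expr0n/= mul0r mulr0 sube0 -/(F _) => E.
  have := ck _ n ch; have := ck _ n cg => ig ih.
  have Ef : (\int[mu]_(x in `[0%R, n%:R]) (f x)%:E =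
      c%:E * \int[mu]_(x in `[0%R, n%:R]) (h x)%:E
      - \int[mu]_(x in `[0%R, n%:R]) (g x)%:E)%E.
    under eq_integral do rewrite EFinB EFinM.
    by rewrite integralB// ?integralZl//; exact: integrableZl.
  have fg : (\int[mu]_(x in `[0%R, n%:R]) (g x)%:E)%E \is a fin_num.
    exact: integrable_fin_num.
  have fh : (\int[mu]_(x in `[0%R, n%:R]) (h x)%:E)%E \is a fin_num.
    exact: integrable_fin_num.
  move: E; rewrite Ef -(fineK fg) -(fineK fh) -EFinM -EFinB => -[<-].
  by rewrite -EFinB; congr EFin; ring.
have restrict (f : R -> R) : continuous f -> (forall x, 0 <= f x) ->
    (\int[mu]_(x in `[0%R, n%:R]) (f x)%:E)%E @[n --> \oo] -->
    (\int[mu]_(x in `[0%R, +oo[) (f x)%:E)%E.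
  move=> cf f0; apply: ge0_cvgn_integral => //.
  exact: continuous_measurable_fun.
have lhs := restrict _ cg g0; have rhs := restrict _ ch h0.
have rhs' : (c%:E * \int[mu]_(x in `[0%R, n%:R]) (h x)%:E - (s ^+ 2 * F n%:R)%:E)%E
    @[n --> \oo] --> (c%:E * \int[mu]_(x in `[0%R, +oo[) (h x)%:E - 0)%E.
  apply: cvgeB => //.
  - by rewrite fin_num_adde_defl.
  - exact: cvgeMl.
  - apply: cvg_EFin; first by near=> n.
    rewrite -[X in _ --> X](mulr0 (s ^+ 2)); apply: cvgMr.
    exact: tail_cvg.
rewrite sube0 in rhs'.
by apply: (cvg_unique _ lhs); [exact: ereal_hausdorff|rewrite /= (eq_cvg _ _ step)].
Unshelve. all: by end_near. Qed.

Lemma normal_even_moment k : (k <= 2)%N -> ~~ odd k ->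
  (\int[normal_prob 0 s]_x (x ^+ k.+2)%:E =
   (s ^+ 2 * k.+1%:R)%:E * \int[normal_prob 0 s]_x (x ^+ k)%:E)%E.
Proof.
have full j : ~~ odd j -> (\int[normal_prob 0 s]_x (x ^+ j)%:E =
    2%:E * \int[mu]_(x in `[0%R, +oo[) (x ^+ j * pdf x)%:E)%E.
  move=> ej; rewrite ge0_integral_normal_prob.
  - under eq_integral do rewrite -EFinM.
    rewrite ge0_symfun_integralT//.
    + congr (_ * _)%E; congr (integral _ _ _).
      by apply/seteqP; split => x/=; rewrite in_itv/= andbT.
    + by move=> x; rewrite mulr_ge0 ?exprn_even_ge0 ?normal_pdf_ge0.
    + by move=> x/=; rewrite -/pdf !pdfE sqrrN exprNn -signr_odd (negbTE ej) mul1r.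
  - by apply/measurable_EFinP; exact: exprn_measurable.
  - by move=> x; rewrite lee_fin exprn_even_ge0.
move=> k2 ek; rewrite !full//= ?negbK// half_moment//.
by rewrite muleCA.
Qed.

Lemma normal_moment2 : (\int[normal_prob 0 s]_x (x ^+ 2)%:E = (s ^+ 2)%:E)%E.
Proof.
rewrite normal_even_moment//; under eq_integral do rewrite expr0.
by rewrite integral_cst//= probability_setT !mulr1 !mule1.
Qed.

Lemma normal_moment4 :
  (\int[normal_prob 0 s]_x (x ^+ 4)%:E = (3 * s ^+ 4)%:E)%E.
Proof.
rewrite normal_even_moment// normal_moment2 -EFinM; congr EFin; ring.
Qed.

End NormalMoments.

(** * Independence *)

Section IndependentReal.
Context d (T : measurableType d) (R : realType) (P : probability T R).
Variables X Y : T -> measurableTypeR R.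
Hypotheses (mX : measurable_fun setT X) (mY : measurable_fun setT Y).
Hypothesis XY : forall A B, measurable A -> measurable B ->
  P (X @^-1` A `&` Y @^-1` B) = (P (X @^-1` A) * P (Y @^-1` B))%E.
Hypotheses (iX : P.-integrable setT (EFin \o X))
           (iY : P.-integrable setT (EFin \o Y)).

Let rvX : {RV P >-> measurableTypeR R} := HB.pack X (isMeasurableFun.Build _ _ _ _ _ mX).
Let rvY : {RV P >-> measurableTypeR R} := HB.pack Y (isMeasurableFun.Build _ _ _ _ _ mY).
Let Z w := (X w, Y w).
Let mZ : measurable_fun setT Z. Proof. exact: measurable_fun_pair. Qed.
Let rvZ : {RV P >-> (measurableTypeR R * measurableTypeR R)%type} :=
  HB.pack Z (isMeasurableFun.Build _ _ _ _ _ mZ).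
Let PX := distribution P rvX.
Let PY := distribution P rvY.
Let PZ := distribution P rvZ.

(** Independence says that the joint law and the product of the marginals agree on rectangles, and
    rectangles determine the product measure. Fubini then turns independence into a product formula
    for integrals. *)
Let joint A : measurable A -> (PX \x PY)%E A = PZ A.
Proof. by move=> mA; apply: product_measure_unique => // B C mB mC; exact: XY. Qed.

Let mprod : measurable_fun [set: measurableTypeR R * measurableTypeR R]
  (fun z : measurableTypeR R * measurableTypeR R => (z.1 * z.2 : R)).
Proof. by apply: measurable_funM. Qed.

Let iXd : PX.-integrable setT (fun x : measurableTypeR R => (x : R)%:E).
Proof. by apply: integrable_pushforward => //; exact/measurable_EFinP. Qed.

Let iYd : PY.-integrable setT (fun x : measurableTypeR R => (x : R)%:E).
Proof. by apply: integrable_pushforward => //; exact/measurable_EFinP. Qed.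

Let iprod : (PX \x PY)%E.-integrable setT
  (fun z : measurableTypeR R * measurableTypeR R => (z.1 * z.2 : R)%:E).
Proof.
apply/integrable12ltyP; first exact/measurable_EFinP.
have mabs : measurable_fun setT (fun x : measurableTypeR R => (`|x : R|)%:E).
  by apply/measurable_EFinP; exact: normr_measurable.
have inner x : (\int[PY]_y `|(x * y : R)%:E| =
    `|x : R|%:E * \int[PY]_y (`|y : R|)%:E)%E.
  rewrite -ge0_integralZl//.
  by apply: eq_integral => y _; rewrite -EFinM -normrM.
under eq_integral => x _ do rewrite /= inner.
rewrite ge0_integralZr//; last exact: integral_ge0.
apply: lte_mul_pinfty; first exact: integral_ge0.
- rewrite ge0_fin_numE; last exact: integral_ge0.
  by case/integrableP : iXd.
- by case/integrableP : iYd.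
Qed.

Lemma integrable_indepM : P.-integrable setT (fun w => (X w * Y w : R)%:E).
Proof.
apply/integrableP; split.
  by apply/measurable_EFinP; exact: measurable_funM.
have /integrableP[_] := iprod.
rewrite (@eq_measure_integral _ _ _ _ PZ); last by move=> A mA _; exact: joint.
rewrite ge0_integral_distribution//.
by apply/measurable_EFinP; exact: measurableT_comp.
Qed.

Lemma Rintegral_indepM :
  \int[P]_w (X w * Y w) = (\int[P]_w X w) * (\int[P]_w Y w).
Proof.
rewrite /Rintegral.
have -> : (\int[P]_w (X w * Y w : R)%:E =
    \int[PZ]_z (z.1 * z.2 : R)%:E)%E.
  rewrite integral_distribution//; last exact: integrable_indepM.
  exact/measurable_EFinP.
rewrite (@eq_measure_integral _ _ _ _ (PX \x PY)%E); last first.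
  by move=> A mA _; exact/esym/joint.
rewrite -integral12_prod_meas1//=.
have EX : (\int[P]_w (X w)%:E = \int[PX]_x (x : R)%:E)%E.
  by rewrite integral_distribution//; exact/measurable_EFinP.
have EY : (\int[P]_w (Y w)%:E = \int[PY]_x (x : R)%:E)%E.
  by rewrite integral_distribution//; exact/measurable_EFinP.
rewrite EX EY.
have fX : (\int[PX]_x (x : R)%:E)%E \is a fin_num by exact: integrable_fin_num.
have fY : (\int[PY]_x (x : R)%:E)%E \is a fin_num by exact: integrable_fin_num.
rewrite /fubini_F -fineM//; congr fine.
under eq_integral => x _.
  under eq_integral => y _ do rewrite /= EFinM.
  rewrite integralZl// -(fineK fY).
  over.
by rewrite integralZr// fineK.
Qed.

End IndependentReal.

(** * One source against the sigma-algebra of all the others *)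

Section IndependentFamilies.
Context d (T : measurableType d) (R : realType) (P : probability T R).

(** For fixed [B], both sides are finite measures in [A]: the restriction of [P] to [B] and [P]
    scaled by [P B]. They agree on a pi-system containing the whole space, hence on the
    sigma-algebra it generates. *)
Lemma indep_g_sigma_algebra (G : set (set T)) (B : set T) :
  G `<=` measurable -> setI_closed G -> G setT -> measurable B ->
  (forall A, G A -> P (A `&` B) = (P A * P B)%E) ->
  forall A, <<s G >> A -> P (A `&` B) = (P A * P B)%E.
Proof.
move=> Gm GI GT mB GB A sGA.
have b0 : 0 <= fine (P B) by rewrite fine_ge0.
have := @g_sigma_algebra_measure_unique _ _ _ G Gm (fun=> setT) (fun=> GT) _
  (mrestr P mB) (mscale (NngNum b0) P) GI _ _ A sGA.
rewrite /= /mrestr /mscale/= fineK ?fin_num_measure// => ->.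
- by rewrite muleC.
- exact: bigcup_const.
- by move=> E GE; rewrite GB// muleC.
- by move=> _; rewrite setTI (le_lt_trans (probability_le1 P mB)) ?ltry.
Qed.

Context {I : finType} {M : nat}.
Variable X : I -> T -> 'cV[R[i]]_M.
Hypothesis mX : forall j, sigma_of (X j) `<=` measurable.
Hypothesis indepX : mutually_independent P X.

(* A pi-system generating the sigma-algebra of the vectors other than [X s]. *)
Definition others (s : I) : set (set T) :=
  [set A | exists E : I -> set T, (forall j, sigma_of (X j) (E j)) /\
     A = \bigcap_(j in [set` [set~ s]%SET]) E j].

Lemma sigma_ofT j : sigma_of (X j) setT.
Proof. exact: (@measurableT _ (g_sigma_algebraType _)). Qed.

Lemma sigma_ofI j A B :
  sigma_of (X j) A -> sigma_of (X j) B -> sigma_of (X j) (A `&` B).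
Proof. exact: (@measurableI _ (g_sigma_algebraType _)). Qed.

Lemma others_measurable s : others s `<=` measurable.
Proof.
move=> _ [E [mE ->]]; apply: fin_bigcap_measurable => //.
by move=> j _; exact: mX (mE j).
Qed.

Lemma sub_others s j : j != s -> sigma_of (X j) `<=` others s.
Proof.
move=> js A sA; exists (fun l => if l == j then A else setT); split.
  by move=> l; case: eqP => [->//|_]; exact: sigma_ofT.
apply/seteqP; split => [w Aw l/= _|w]; first by case: eqP.
by move=> /(_ j); rewrite eqxx; apply; rewrite /= in_setC1.
Qed.

Lemma indep_others s A B :
  <<s others s >> A -> sigma_of (X s) B -> P (A `&` B) = (P A * P B)%E.
Proof.
move=> sA sB; apply: (indep_g_sigma_algebra _ _ _ _ _ sA).
- exact: others_measurable.
- move=> _ _ [E [mE ->]] [F [mF ->]]; exists (fun j => E j `&` F j); split.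
    by move=> j; exact: sigma_ofI.
  by rewrite bigcapI.
- exists (fun=> setT); split; first by move=> j; exact: sigma_ofT.
  by apply/seteqP; split.
- exact: mX sB.
- move=> _ [E [mE ->]].
  (* Putting [B] in the missing slot [s] turns the event into an intersection over all indices, to
     which mutual independence applies; its product then splits off the factor [s]. *)
  pose F j := if j == s then B else E j.
  have mF j : sigma_of (X j) (F j) by rewrite /F; case: eqP => [->|].
  have -> : \bigcap_(j in [set` [set~ s]%SET]) E j `&` B =
      \bigcap_(j in [set` [set: I]%SET]) F j.
    apply/seteqP; split => [w [Ew Bw] j _|w Fw].
      rewrite /F; case: eqP => [_//|/eqP js].
      by apply: Ew; rewrite /= in_setC1.
    split; last by have := Fw s; rewrite /F eqxx; apply; rewrite /= inE.
    move=> j; rewrite /= in_setC1 => js.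
    by have := Fw j; rewrite /F (negbTE js); apply; rewrite /= inE.
  rewrite !indepX; [|by move=> j _; exact: mE|by move=> j _; exact: mF].
  rewrite (bigD1 s) ?finset.in_setT//= {1}/F eqxx muleC; congr (_ * _)%E.
  apply: eq_big => [j|j]; first by rewrite in_setC1 finset.in_setT.
  by rewrite finset.in_setT/= /F => /negbTE->.
Qed.

End IndependentFamilies.

(** * Complex random variables *)

Section ComplexNorm.
Context {R : realType}.
Implicit Types z : R[i].

Lemma normcE2 z : normc z = Num.sqrt (\Re z ^+ 2 + \Im z ^+ 2).
Proof. by case: z. Qed.

Lemma normc_ge0 z : 0 <= normc z. Proof. by rewrite normcE2 sqrtr_ge0. Qed.

Lemma sqr_normc2 z : normc z ^+ 2 = \Re z ^+ 2 + \Im z ^+ 2.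
Proof. by rewrite normcE2 sqr_sqrtr// addr_ge0// sqr_ge0. Qed.

Lemma normc_real (x : R) : normc x%:C = `|x|.
Proof. by rewrite normcE2/= expr0n addr0 sqrtr_sqr. Qed.

Lemma normc_conj z : normc z^* = normc z.
Proof. by rewrite !normcE2; case: z => a b /=; rewrite sqrrN. Qed.

Lemma mul_conj_normc z : z * z^* = (normc z ^+ 2)%:C.
Proof.
rewrite sqr_normc2; case: z => a b; apply: (f_equal2 (@Complex R)) => /=; ring.
Qed.

Lemma Re_le_normc z : `|\Re z| <= normc z.
Proof. by rewrite normcE2 -sqrtr_sqr ler_wsqrtr// lerDl sqr_ge0. Qed.

Lemma Im_le_normc z : `|\Im z| <= normc z.
Proof. by rewrite normcE2 -sqrtr_sqr ler_wsqrtr// lerDr sqr_ge0. Qed.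

Lemma normc_le_ReIm z : normc z <= `|\Re z| + `|\Im z|.
Proof.
rewrite normcE2 -[leRHS]ger0_norm ?addr_ge0// -sqrtr_sqr ler_wsqrtr//.
by rewrite sqrrD !real_normK ?num_real// addrAC lerDl mulrn_wge0// mulr_ge0.
Qed.

Lemma ReD z1 z2 : \Re (z1 + z2) = \Re z1 + \Re z2.
Proof. by case: z1 z2 => [a b] [c e]. Qed.
Lemma ImD z1 z2 : \Im (z1 + z2) = \Im z1 + \Im z2.
Proof. by case: z1 z2 => [a b] [c e]. Qed.
Lemma ReM z1 z2 : \Re (z1 * z2) = \Re z1 * \Re z2 - \Im z1 * \Im z2.
Proof. by case: z1 z2 => [a b] [c e]. Qed.
Lemma ImM z1 z2 : \Im (z1 * z2) = \Re z1 * \Im z2 + \Im z1 * \Re z2.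
Proof. by case: z1 z2 => [a b] [c e]. Qed.
Lemma Re_conj z : \Re z^* = \Re z. Proof. by case: z. Qed.
Lemma Im_conj z : \Im z^* = - \Im z. Proof. by case: z. Qed.

Lemma conj_realc (x : R) : (x%:C : R[i])^* = x%:C.
Proof. exact: conjc_real. Qed.

Lemma sqrtC_realc (x : R) : 0 <= x -> sqrtC x%:C = (Num.sqrt x)%:C :> R[i].
Proof.
move=> x0; rewrite -[in LHS](sqr_sqrtr x0) rmorphXn/= sqrCK//.
by rewrite ler0c sqrtr_ge0.
Qed.

End ComplexNorm.

Section ComplexMeasurable.
Context d (T : measurableType d) (R : realType).
Implicit Types f g : T -> R[i].

Definition cmeasurable f : Prop :=
  measurable_fun setT (fun w => \Re (f w)) /\
  measurable_fun setT (fun w => \Im (f w)).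

Lemma cmeasurable_cst z : cmeasurable (fun=> z).
Proof. by split; exact: measurable_cst. Qed.

Lemma cmeasurableD f g :
  cmeasurable f -> cmeasurable g -> cmeasurable (fun w => f w + g w).
Proof.
by move=> [f1 f2] [g1 g2]; split;
  [under eq_fun do rewrite ReD|under eq_fun do rewrite ImD];
  exact: measurable_funD.
Qed.

Lemma cmeasurableM f g :
  cmeasurable f -> cmeasurable g -> cmeasurable (fun w => f w * g w).
Proof.
move=> [f1 f2] [g1 g2]; split.
- under eq_fun do rewrite ReM.
  by apply: measurable_funB; exact: measurable_funM.
- under eq_fun do rewrite ImM.
  by apply: measurable_funD; exact: measurable_funM.
Qed.

Lemma cmeasurable_conj f : cmeasurable f -> cmeasurable (fun w => (f w)^*).
Proof.
move=> [f1 f2]; split; first by under eq_fun do rewrite Re_conj.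
by under eq_fun do rewrite Im_conj; exact: measurable_funN.
Qed.

Lemma cmeasurable_sum (J : Type) (r : seq J) (F : J -> T -> R[i]) :
  (forall j, cmeasurable (F j)) -> cmeasurable (fun w => \sum_(j <- r) F j w).
Proof.
move=> mF; elim: r => [|j r ih].
  by under eq_fun do rewrite big_nil; exact: cmeasurable_cst.
by under eq_fun do rewrite big_cons; exact: cmeasurableD.
Qed.

Lemma cmeasurable_realP (f : T -> R) :
  cmeasurable (fun w => (f w)%:C) <-> measurable_fun setT f.
Proof. by split => [[]//|mf]; split => //; exact: measurable_cst. Qed.

Lemma measurable_normc f : cmeasurable f ->
  measurable_fun setT (fun w => normc (f w)).
Proof.
move=> [f1 f2]; under eq_fun do rewrite normcE2.
apply: (measurable_comp measurableT) => //=.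
  by apply: continuous_measurable_fun; exact: sqrt_continuous.
by apply: measurable_funD; exact: measurable_funX.
Qed.

End ComplexMeasurable.

(** * Integrability and expectation of complex variables *)

Section ComplexLp.
Context d (T : measurableType d) (R : realType) (P : probability T R).
Implicit Types f g : T -> R[i].

Definition cLp (p : nat) f : Prop :=
  cmeasurable f /\ P.-integrable setT (fun w => (normc (f w) ^+ p)%:E).

Local Notation E := (cexpectation P).

Lemma cLp_le p f (g : T -> R) : cmeasurable f ->
  (forall w, normc (f w) ^+ p <= g w) ->
  P.-integrable setT (fun w => (g w)%:E) -> cLp p f.
Proof.
move=> mf fg ig; split => //; apply: le_integrable ig => //.
  apply/measurable_EFinP; apply: measurable_funX; exact: measurable_normc.
move=> w _ /=; rewrite lee_fin ger0_norm ?exprn_ge0 ?normc_ge0//.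
exact: le_trans (ler_norm _).
Qed.

Lemma exprDn_le p (a b : R) : 0 <= a -> 0 <= b ->
  (a + b) ^+ p <= 2 ^+ p * (a ^+ p + b ^+ p).
Proof.
move=> a0 b0; wlog ab : a b a0 b0 / a <= b.
  by have [ab|/ltW ba] := leP a b => H; [|rewrite addrC [X in _ * X]addrC]; exact: H.
apply: (@le_trans _ _ ((2 * b) ^+ p)).
  by apply: lerXn2r; rewrite ?nnegrE; lra.
by rewrite exprMn ler_pM2l ?exprn_gt0// lerDr exprn_ge0.
Qed.

Lemma cLp_cst p z : cLp p (fun=> z).
Proof.
split; first exact: cmeasurable_cst.
exact: finite_measure_integrable_cst.
Qed.

Lemma cLpD p f g : cLp p f -> cLp p g -> cLp p (fun w => f w + g w).
Proof.
move=> [mf If] [mg Ig].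
apply: (@cLp_le _ _ (fun w => 2 ^+ p * (normc (f w) ^+ p + normc (g w) ^+ p))).
- exact: cmeasurableD.
- move=> w; apply: le_trans (exprDn_le _ (normc_ge0 _) (normc_ge0 _)).
  by apply: lerXn2r; rewrite ?nnegrE ?addr_ge0 ?normc_ge0//; exact: le_normcD.
- under eq_fun do rewrite EFinM EFinD.
  by apply: integrableZl => //; exact: integrableD.
Qed.

Lemma cLpZ p z f : cLp p f -> cLp p (fun w => z * f w).
Proof.
move=> [mf If].
apply: (@cLp_le _ _ (fun w => normc z ^+ p * normc (f w) ^+ p)).
- by apply: cmeasurableM => //; exact: cmeasurable_cst.
- by move=> w; rewrite Normc.normcM exprMn.
- by under eq_fun do rewrite EFinM; exact: integrableZl.
Qed.

Lemma cLp_conj p f : cLp p f -> cLp p (fun w => (f w)^*).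
Proof.
move=> [mf If]; split; first exact: cmeasurable_conj.
by under eq_fun do rewrite normc_conj.
Qed.

Lemma cLp_sum p (J : Type) (r : seq J) (F : J -> T -> R[i]) :
  (forall j, cLp p (F j)) -> cLp p (fun w => \sum_(j <- r) F j w).
Proof.
move=> mF; elim: r => [|j r ih].
  by under eq_fun do rewrite big_nil; exact: cLp_cst.
by under eq_fun do rewrite big_cons; exact: cLpD.
Qed.

(** The equal-exponent case of Hölder, through the pointwise bound [a * b <= a ^+ 2 + b ^+ 2]. Each
    product halves the exponent. *)
Lemma cLpM p f g : cLp (p + p) f -> cLp (p + p) g -> cLp p (fun w => f w * g w).
Proof.
move=> [mf If] [mg Ig].
apply: (@cLp_le _ _ (fun w => normc (f w) ^+ (p + p) + normc (g w) ^+ (p + p))).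
- exact: cmeasurableM.
- move=> w; rewrite Normc.normcM exprMn !exprD.
  set a := normc _ ^+ p; set b := normc _ ^+ p; nra.
- by under eq_fun do rewrite EFinD; exact: integrableD.
Qed.

Lemma cLpW p f : cLp (p + p) f -> cLp p f.
Proof.
move=> Lf; have := cLpM Lf (cLp_cst (p + p) 1).
by under eq_fun do rewrite mulr1.
Qed.

Lemma cLp1P f : cLp 1 f <->
  P.-integrable setT (fun w => (\Re (f w))%:E) /\
  P.-integrable setT (fun w => (\Im (f w))%:E).
Proof.
split=> [[[mr mi] If]|[Ir Ii]].
  split; apply: le_integrable If => //; try exact/measurable_EFinP.
    by move=> w _ /=; rewrite lee_fin expr1 (le_trans (Re_le_normc _))// ler_norm.
  by move=> w _ /=; rewrite lee_fin expr1 (le_trans (Im_le_normc _))// ler_norm.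
apply: (@cLp_le _ _ (fun w => `|\Re (f w)| + `|\Im (f w)|)).
- by split; apply/measurable_EFinP; [have/measurable_int := Ir|have/measurable_int := Ii].
- by move=> w; rewrite expr1; exact: normc_le_ReIm.
- under eq_fun do rewrite EFinD.
  by apply: integrableD => //; [apply: (integrable_abse Ir)|apply: (integrable_abse Ii)].
Qed.

Lemma cexpectationE f :
  E f = (\int[P]_w \Re (f w)) +i* (\int[P]_w \Im (f w)).
Proof. by rewrite /cexpectation unlock. Qed.

Lemma eq_cexpectation f g : f =1 g -> E f = E g.
Proof. by move=> /funext ->. Qed.

Lemma cexpectation_cst z : E (fun=> z) = z.
Proof.
rewrite cexpectationE !Rintegral_cst//= probability_setT/= !mulr1.
by case: z.
Qed.

Lemma cexpectationD f g : cLp 1 f -> cLp 1 g ->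
  E (fun w => f w + g w) = E f + E g.
Proof.
move=> /cLp1P[f1 f2] /cLp1P[g1 g2]; rewrite !cexpectationE.
under eq_Rintegral do rewrite ReD.
under [X in _ +i* X]eq_Rintegral do rewrite ImD.
by rewrite !RintegralD.
Qed.

Lemma cexpectationZ z f : cLp 1 f -> E (fun w => z * f w) = z * E f.
Proof.
move=> /cLp1P[f1 f2]; rewrite !cexpectationE.
under eq_Rintegral do rewrite ReM.
under [X in _ +i* X]eq_Rintegral do rewrite ImM.
rewrite RintegralB ?RintegralD ?RintegralZl//.
- by case: z => a b.
- by have := integrableZl measurableT (\Re z) f2.
- by have := integrableZl measurableT (\Im z) f1.
- by have := integrableZl measurableT (\Re z) f1.
- by have := integrableZl measurableT (\Im z) f2.
Qed.

Lemma cexpectation_conj f : cLp 1 f -> E (fun w => (f w)^*) = (E f)^*.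
Proof.
move=> /cLp1P[_ f2]; rewrite !cexpectationE; congr (_ +i* _).
  by apply: eq_Rintegral => w _; rewrite Re_conj.
rewrite -mulN1r -RintegralZl//.
by apply: eq_Rintegral => w _; rewrite Im_conj mulN1r.
Qed.

Lemma cexpectation_sum (J : Type) (r : seq J) (F : J -> T -> R[i]) :
  (forall j, cLp 1 (F j)) ->
  E (fun w => \sum_(j <- r) F j w) = \sum_(j <- r) E (F j).
Proof.
move=> mF; elim: r => [|j r ih].
  rewrite big_nil -[RHS]cexpectation_cst.
  by congr (E _); apply/funext => w; rewrite big_nil.
rewrite big_cons -ih -cexpectationD//; last exact: cLp_sum.
by congr (E _); apply/funext => w; rewrite big_cons.
Qed.

Lemma second_momentE f : (second_moment P f)%:C = E (fun w => f w * (f w)^*).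
Proof.
rewrite cexpectationE /second_moment unlock.
have -> : \int[P]_w \Im (f w * (f w)^*) = 0.
  by rewrite /Rintegral integral0_eq// => w _; rewrite mul_conj_normc.
by congr (_ +i* _); apply: eq_Rintegral => w _; rewrite mul_conj_normc.
Qed.

Section Independent.
Variables (G H : set (set T)).
Hypotheses (mG : G `<=` measurable) (mH : H `<=` measurable).
Hypothesis indepGH : forall A B, <<s G >> A -> <<s H >> B ->
  P (A `&` B) = (P A * P B)%E.

Lemma sub_measurable_fun (K : set (set T)) (X : T -> R) : K `<=` measurable ->
  measurable_fun (setT : set (g_sigma_algebraType K)) X -> measurable_fun setT X.
Proof.
move=> mK mX _ B mB; have := mX measurableT _ mB.
by apply: smallest_sub => //; exact: sigma_algebra_measurable.
Qed.

Lemma sub_cmeasurable (K : set (set T)) f : K `<=` measurable ->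
  cmeasurable (f : g_sigma_algebraType K -> R[i]) -> cmeasurable f.
Proof. by move=> mK [f1 f2]; split; exact: sub_measurable_fun mK _. Qed.

Let indep_real (X Y : T -> R) :
  measurable_fun (setT : set (g_sigma_algebraType G)) X ->
  measurable_fun (setT : set (g_sigma_algebraType H)) Y ->
  P.-integrable setT (EFin \o X) -> P.-integrable setT (EFin \o Y) ->
  P.-integrable setT (fun w => (X w * Y w)%:E) /\
  \int[P]_w (X w * Y w) = (\int[P]_w X w) * (\int[P]_w Y w).
Proof.
move=> mX mY iX iY.
have mX' := sub_measurable_fun mG mX; have mY' := sub_measurable_fun mH mY.
have XY A B : measurable A -> measurable B ->
    P (X @^-1` A `&` Y @^-1` B) = (P (X @^-1` A) * P (Y @^-1` B))%E.
  move=> mA mB; apply: indepGH.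
    by rewrite -[X in <<s _ >> X]setTI; exact: mX.
  by rewrite -[X in <<s _ >> X]setTI; exact: mY.
by split; [exact: integrable_indepM XY _ _|exact: Rintegral_indepM].
Qed.

(** Under independence the exponent is preserved instead of halved. This puts the product of an
    amplitude and a noise coordinate, hence the pilot observation, in L^4 from L^4 bounds alone. *)
Lemma cLp_indepM p f g :
  cmeasurable (f : g_sigma_algebraType G -> R[i]) ->
  cmeasurable (g : g_sigma_algebraType H -> R[i]) ->
  cLp p f -> cLp p g -> cLp p (fun w => f w * g w).
Proof.
move=> mf mg [mf' If] [mg' Ig]; split; first exact: cmeasurableM.
under eq_fun do rewrite Normc.normcM exprMn.
have [] := @indep_real (fun w => normc (f w) ^+ p) (fun w => normc (g w) ^+ p) => //.
- by apply: measurable_funX; exact: measurable_normc.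
- by apply: measurable_funX; exact: measurable_normc.
Qed.

Lemma cexpectation_indepM f g :
  cmeasurable (f : g_sigma_algebraType G -> R[i]) ->
  cmeasurable (g : g_sigma_algebraType H -> R[i]) ->
  cLp 1 f -> cLp 1 g -> E (fun w => f w * g w) = E f * E g.
Proof.
move=> [fr fi] [gr gi] /cLp1P[f1 f2] /cLp1P[g1 g2]; rewrite !cexpectationE.
have [rr1 rr2] := indep_real fr gr f1 g1.
have [ri1 ri2] := indep_real fr gi f1 g2.
have [ir1 ir2] := indep_real fi gr f2 g1.
have [ii1 ii2] := indep_real fi gi f2 g2.
under eq_Rintegral do rewrite ReM.
under [X in _ +i* X]eq_Rintegral do rewrite ImM.
by rewrite RintegralB ?RintegralD// rr2 ri2 ir2 ii2.
Qed.

End Independent.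
End ComplexLp.

(** * Polarization *)

Section Polarization.
Context {C : numClosedFieldType} {V : lmodType C}.

Definition sesquilinear_form (G : V -> V -> C) : Prop :=
  [/\ forall u u' v, G (u + u') v = G u v + G u' v,
      forall u v v', G u (v + v') = G u v + G u v',
      forall a u v, G (a *: u) v = a * G u v &
      forall a u v, G u (a *: v) = a^* * G u v].

(** Expanding the diagonal at [u + v] and at [u + 'i *: v] gives two linear equations in [G u v] and
    [G v u]; [E3] combines them so that [G v u] drops out. *)
Lemma sesquilinear_eq (G H : V -> V -> C) :
  sesquilinear_form G -> sesquilinear_form H ->
  (forall u, G u u = H u u) -> forall u v, G u v = H u v.
Proof.
move=> [G1 G2 G3 G4] [H1 H2 H3 H4] GH u v.
have E1 : G u v + G v u = H u v + H v u.
  have := GH (u + v); rewrite !(G1, G2, H1, H2) !GH => /eqP.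
  rewrite -subr_eq0 => /eqP E; apply/eqP; rewrite -subr_eq0 -[eqbRHS]E.
  by apply/eqP; ring.
have E2 : - ('i * G u v) + 'i * G v u = - ('i * H u v) + 'i * H v u.
  have := GH (u + 'i *: v).
  rewrite !(G1, G2, H1, H2) !(G3, G4, H3, H4) !GH conjCi => /eqP.
  rewrite -subr_eq0 => /eqP E; apply/eqP; rewrite -subr_eq0 -[eqbRHS]E.
  by apply/eqP; ring.
have E3 : 'i * (2 * (G u v - H u v)) = 0 :> C.
  transitivity ('i * ((G u v + G v u) - (H u v + H v u)) -
    ((- ('i * G u v) + 'i * G v u) - (- ('i * H u v) + 'i * H v u))).
    by ring.
  by rewrite E1 E2 !subrr mulr0 subrr.
move/eqP: E3; rewrite !mulf_eq0 (negbTE (neq0Ci C)) pnatr_eq0/= subr_eq0.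
by move/eqP.
Qed.

(** The form is linear in slots 1 and 3, conjugate linear in slots 2 and 4, and symmetric within
    each pair. Vanishing is propagated from [D u u u u] to [D x y x y], then to [D a b c b], then to
    all arguments. *)
Lemma quartic_eq0 (D : V -> V -> V -> V -> C) :
  (forall a b c d, D a b c d = D c b a d) ->
  (forall a b c d, D a b c d = D a d c b) ->
  (forall a a' b c d, D (a + a') b c d = D a b c d + D a' b c d) ->
  (forall a b b' c d, D a (b + b') c d = D a b c d + D a b' c d) ->
  (forall k a b c d, D (k *: a) b c d = k * D a b c d) ->
  (forall k a b c d, D a (k *: b) c d = k^* * D a b c d) ->
  (forall u, D u u u u = 0) -> forall a b c d, D a b c d = 0.
Proof.
move=> S13 S24 D1 D2 Z1 Z2 D0.
have D3 a b c c' d : D a b (c + c') d = D a b c d + D a b c' d.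
  by rewrite S13 D1 S13 (S13 c').
have D4 a b c d d' : D a b c (d + d') = D a b c d + D a b c d'.
  by rewrite S24 D2 S24 (S24 _ d').
have Z3 k a b c d : D a b (k *: c) d = k * D a b c d by rewrite S13 Z1 S13.
have Z4 k a b c d : D a b c (k *: d) = k^* * D a b c d by rewrite S24 Z2 S24.
(* Weighting the expansions at [x + w y], w = 1, -1, i, -i, by [w^2] leaves
   only the terms of degree (2,0) and (0,2) in [w] and its conjugate. *)
have even_part x y : D y x y x + D x y x y = 0.
  have Ew w : w * w^* = 1 ->
      (D x x x x + D y y y y + D x x y y + D x y y x + D y x x y + D y y x x)
      + ((w * w) * D y x y x + (w^* * w^*) * D x y x y)
      + w * (D y x x x + D x x y x + D y y y x + D y x y y)
      + w^* * (D x y x x + D x x x y + D y y x y + D x y y y) = 0.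
    move=> w1; rewrite -[RHS](D0 (x + w *: y)).
    rewrite !(D1, D2, D3, D4) !(Z1, Z2, Z3, Z4).
    ring: w1.
  have i2 : 'i * 'i = -1 :> C by rewrite -expr2 sqrCi.
  have := Ew 1; rewrite conjC1 !mulr1 => /(_ erefl) e1.
  have := Ew (-1); rewrite rmorphN1 mulrNN !mulr1 => /(_ erefl) e2.
  have := Ew 'i; rewrite conjCi mulrNN mulrN i2 opprK => /(_ erefl) e3.
  have := Ew (- 'i).
  rewrite rmorphN/= conjCi opprK mulrNN mulNr i2 opprK => /(_ erefl) e4.
  set S := D y x y x + D x y x y.
  have : S *+ 4 = 0.
    transitivity (0 + 0 - 0 - 0 : C); last by ring.
    by rewrite -{1}e1 -{1}e2 -{1}e3 -{1}e4 /S -mulr_natl; ring.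
  by move/eqP; rewrite mulrn_eq0/= => /eqP.
(* Replacing [y] by [(1 + 'i) *: y] multiplies the two terms of [even_part] by (1 + i)^2 = 2i and by
   its conjugate -2i. The sum and the difference of the terms therefore both vanish. *)
have diag x y : D x y x y = 0.
  have A := even_part x y; have := even_part x ((1 + 'i) *: y).
  have cj : (1 + 'i)^* = 1 - 'i :> C by rewrite rmorphD/= conjC1 conjCi.
  rewrite !(Z1, Z2, Z3, Z4) cj => B.
  have i2 : 'i * 'i = -1 :> C by rewrite -expr2 sqrCi.
  have : 'i * (D x y x y *+ 4) = 0.
    transitivity ('i * 2 * (D y x y x + D x y x y) -
      ((1 + 'i) * ((1 + 'i) * D y x y x) + (1 - 'i) * ((1 - 'i) * D x y x y))).
      rewrite -mulr_natl; ring: i2.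
    by rewrite A B; ring.
  by move/eqP; rewrite mulf_eq0 (negbTE (neq0Ci C)) mulrn_eq0/= => /eqP.
(* Polarization in slots 1 and 3: at [a + c] only the two equal mixed terms remain. The last lines
   do the same in slots 2 and 4. *)
have pol1 a b c : D a b c b = 0.
  have := diag (a + c) b; rewrite D1 !D3 !diag add0r addr0 (S13 c) -mulr2n.
  by move/eqP; rewrite mulrn_eq0/= => /eqP.
move=> a b c d.
have := pol1 a (b + d) c; rewrite D2 !D4 !pol1 add0r addr0 (S24 _ d) -mulr2n.
by move/eqP; rewrite mulrn_eq0/= => /eqP.
Qed.

(** The algebraic core of Wick's formula for circular Gaussian variables: each unconjugated slot is
    paired with a conjugated one, and on the diagonal the two pairings coincide, which explains the
    factor 2. *)
Lemma quartic_of_diag (F : V -> V -> V -> V -> C) (q : V -> V -> C) :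
  sesquilinear_form q ->
  (forall a b c d, F a b c d = F c b a d) ->
  (forall a b c d, F a b c d = F a d c b) ->
  (forall c d, sesquilinear_form (fun a b => F a b c d)) ->
  (forall u, F u u u u = 2 * q u u ^+ 2) ->
  forall a b c d, F a b c d = q a b * q c d + q a d * q c b.
Proof.
move=> [q1 q2 q3 q4] S13 S24 Fs Fd a b c d; apply/eqP; rewrite -subr_eq0; apply/eqP.
pose D a b c d := F a b c d - (q a b * q c d + q a d * q c b).
rewrite -/(D a b c d); apply: quartic_eq0 => {a b c d}.
- by move=> a b c d; rewrite /D S13; congr (_ - _); ring.
- by move=> a b c d; rewrite /D S24; congr (_ - _); ring.
- by move=> a a' b c d; rewrite /D; have [-> _ _ _] := Fs c d; rewrite !q1; ring.
- by move=> a b b' c d; rewrite /D; have [_ -> _ _] := Fs c d; rewrite !q2; ring.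
- by move=> k a b c d; rewrite /D; have [_ _ -> _] := Fs c d; rewrite !q3; ring.
- by move=> k a b c d; rewrite /D; have [_ _ _ ->] := Fs c d; rewrite !q4; ring.
- by move=> u; rewrite /D Fd; ring.
Qed.

End Polarization.

(** * Moments of complex normal vectors *)

Section CenteredNormal.
Context d (T : measurableType d) (R : realType) (P : probability T R).
Variables (v : R) (Y : T -> R).
Hypothesis v_ge0 : 0 <= v.
Hypothesis mY : measurable_fun setT Y.
Hypothesis lawY : forall A : set (measurableTypeR R), measurable A ->
  P (Y @^-1` A) = centered_normal v A.

Let mY' : measurable_fun setT (Y : T -> measurableTypeR R). Proof. exact: mY. Qed.
Let rvY : {RV P >-> measurableTypeR R} :=
  HB.pack (Y : T -> measurableTypeR R) (isMeasurableFun.Build _ _ _ _ _ mY').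

(** The candidate [c] has to fit both branches of [centered_normal]: the density with standard
    deviation [Num.sqrt v], and the Dirac mass at 0, whose moment is [0 ^+ k]. *)
Let even_moment (c : R) k : ~~ odd k ->
  (forall s : R, 0 < s -> s ^+ 2 = v ->
    (\int[normal_prob 0 s]_x (x ^+ k)%:E = c%:E)%E) ->
  (v = 0 -> c = 0 ^+ k) ->
  (\int[P]_w (Y w ^+ k)%:E = c%:E)%E.
Proof.
move=> ek cs c0.
have mXk : measurable_fun setT (fun x : measurableTypeR R => (x ^+ k : R)%:E).
  by apply/measurable_EFinP; exact: exprn_measurable.
have Xk0 (x : measurableTypeR R) : (0 <= (x ^+ k : R)%:E)%E.
  by rewrite lee_fin exprn_even_ge0.
have -> : (\int[P]_w (Y w ^+ k)%:E =
    \int[distribution P rvY]_x (x ^+ k : R)%:E)%E.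
  by rewrite ge0_integral_distribution.
have [v0|v0] := eqVneq v 0.
  rewrite (@eq_measure_integral _ _ _ _ (dirac (0 : measurableTypeR R))).
    by rewrite integral_dirac// diracT mul1e c0.
  by move=> A mA _; have := lawY mA; rewrite /centered_normal v0 eqxx; exact.
have sv : 0 < Num.sqrt v by rewrite sqrtr_gt0 lt_def v0.
rewrite (@eq_measure_integral _ _ _ _ (normal_prob 0 (Num.sqrt v))).
  by rewrite cs// sqr_sqrtr.
by move=> A mA _; have := lawY mA; rewrite /centered_normal (negbTE v0); exact.
Qed.

Lemma centered_normal_moment2 : (\int[P]_w (Y w ^+ 2)%:E = v%:E)%E.
Proof.
apply: even_moment => //; last by move=> ->; rewrite expr0n.
by move=> s s0 <-; exact: normal_moment2.
Qed.

Lemma centered_normal_moment4 : (\int[P]_w (Y w ^+ 4)%:E = (3 * v ^+ 2)%:E)%E.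
Proof.
apply: even_moment => //; last by move=> ->; rewrite !expr0n mulr0.
by move=> s s0 <-; rewrite -exprM; exact: normal_moment4.
Qed.

Lemma integrable_centered_normal4 : P.-integrable setT (fun w => (Y w ^+ 4)%:E).
Proof.
apply/integrableP; split.
  by apply/measurable_EFinP; exact: measurable_funX.
under eq_integral do rewrite /= ger0_norm ?exprn_even_ge0//.
by rewrite centered_normal_moment4 ltry.
Qed.

End CenteredNormal.

Section ComplexNormal.
Context d (T : measurableType d) (R : realType) (P : probability T R) (M : nat).
Variables (S : 'M[R[i]]_M) (X : T -> 'cV[R[i]]_M).
Hypotheses (S_psd : hermitian_psd S) (X_CN : is_CN P S X).
Implicit Types (u v : 'rV[R[i]]_M) (w : T).

Local Notation E := (cexpectation P).

(** Row vectors index the functionals, so that [lin] is complex linear in its index, where [hdot] is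
    conjugate linear; polarization is carried out in this index. *)
Definition lin u (x : 'cV[R[i]]_M) : R[i] := (u *m x) 0 0.

Definition cov (A : 'M[R[i]]_M) u v : R[i] := (u *m A *m v^t*) 0 0.

Lemma linD u u' x : lin (u + u') x = lin u x + lin u' x.
Proof. by rewrite /lin mulmxDl mxE. Qed.

Lemma linZ k u x : lin (k *: u) x = k * lin u x.
Proof. by rewrite /lin -scalemxAl mxE. Qed.

Lemma linE u x : lin u x = \sum_j u 0 j * x j 0.
Proof. by rewrite /lin mxE. Qed.

Lemma covDl A u u' v : cov A (u + u') v = cov A u v + cov A u' v.
Proof. by rewrite /cov !mulmxDl mxE. Qed.

Lemma covDr A u v v' : cov A u (v + v') = cov A u v + cov A u v'.
Proof. by rewrite /cov linearD/= map_mxD mulmxDr mxE. Qed.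

Lemma covZl A k u v : cov A (k *: u) v = k * cov A u v.
Proof. by rewrite /cov -!scalemxAl mxE. Qed.

Lemma covZr A k u v : cov A u (k *: v) = k^* * cov A u v.
Proof. by rewrite /cov linearZ/= map_mxZ -scalemxAr mxE. Qed.

Lemma cov_ge0 u : 0 <= cov S u u.
Proof. by have [_ /(_ (u^t*))] := S_psd; rewrite trmxCK. Qed.

Let cov_real u : cov S u u = (\Re (cov S u u))%:C.
Proof.
have := cov_ge0 u; rewrite lecE => /andP[/eqP i0 _].
by rewrite [LHS]complexE i0 mulr0 addr0.
Qed.

Let var u : R := \Re (cov S u u) / 2.

Let var_ge0 u : 0 <= var u.
Proof. by rewrite divr_ge0//; have := cov_ge0 u; rewrite lecE => /andP[]. Qed.

Lemma cmeasurable_coord j : cmeasurable (fun w => X w j 0).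
Proof. by have [/(_ j)] := X_CN. Qed.

Lemma cmeasurable_lin u : cmeasurable (fun w => lin u (X w)).
Proof.
under eq_fun do rewrite linE; apply: cmeasurable_sum => j.
by apply: cmeasurableM; [exact: cmeasurable_cst|exact: cmeasurable_coord].
Qed.

Let law u A : measurable A ->
  P ((fun w => \Re (lin u (X w))) @^-1` A) = centered_normal (var u) A.
Proof.
move=> mA; have [_ /(_ (u^t*) A mA)] := X_CN.
by rewrite /hdot trmxCK mulmxA.
Qed.

Let mRe u := (cmeasurable_lin u).1.

Let moment2 u := centered_normal_moment2 (var_ge0 u) (mRe u) (@law u).
Let moment4 u := centered_normal_moment4 (var_ge0 u) (mRe u) (@law u).
Let integrable4 u := integrable_centered_normal4 (var_ge0 u) (mRe u) (@law u).

(** The assumed laws concern real parts only; rotating the functional by [- 'i] makes them cover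
    imaginary parts as well. *)
Let Im_lin u x : \Im (lin u x) = \Re (lin (- 'i *: u) x).
Proof.
rewrite linZ ReM; case: (lin u x) => a b /=.
by rewrite oppr0 mul0r sub0r mulN1r opprK.
Qed.

Let varZ k u : var (k *: u) = normc k ^+ 2 * var u.
Proof.
rewrite /var covZl covZr mulrA mul_conj_normc ReM/= mul0r subr0.
by rewrite mulrA.
Qed.

Lemma cLp4_lin u : cLp P 4 (fun w => lin u (X w)).
Proof.
apply: (@cLp_le _ _ _ _ _ _ (fun w => 2 * (\Re (lin u (X w)) ^+ 4 +
    \Re (lin (- 'i *: u) (X w)) ^+ 4))); first exact: cmeasurable_lin.
- move=> w; rewrite (exprM _ 2 2) sqr_normc2 -Im_lin.
  set a := \Re _; set b := \Im _.
  have -> : a ^+ 4 = (a ^+ 2) ^+ 2 by ring.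
  have -> : b ^+ 4 = (b ^+ 2) ^+ 2 by ring.
  by rewrite -subr_ge0; have := sqr_ge0 (a ^+ 2 - b ^+ 2); lra.
- have := integrableD measurableT (integrable4 u) (integrable4 (- 'i *: u)).
  by move=> /(integrableZl measurableT 2).
Qed.

Lemma cLp2_lin u : cLp P 2 (fun w => lin u (X w)).
Proof. by apply: (@cLpW _ _ _ _ 2); exact: cLp4_lin. Qed.

Lemma cLp1_lin u : cLp P 1 (fun w => lin u (X w)).
Proof. by apply: (@cLpW _ _ _ _ 1); exact: cLp2_lin. Qed.

(* [Re (lin u X)] and its opposite [Re (lin (- u) X)] have the same law. *)
Let mean_Re u : \int[P]_w \Re (lin u (X w)) = 0.
Proof.
pose Y u w : measurableTypeR R := \Re (lin u (X w)).
have mY u' : measurable_fun setT (Y u') := mRe u'.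
pose rvY u' : {RV P >-> measurableTypeR R} :=
  HB.pack (Y u') (isMeasurableFun.Build _ _ _ _ _ (mY u')).
have iY u' : P.-integrable setT (fun w => (Y u' w : R)%:E).
  by have /cLp1P[] := cLp1_lin u'.
have EY u' : (\int[P]_w (Y u' w : R)%:E =
    \int[distribution P (rvY u')]_x (x : R)%:E)%E.
  by rewrite integral_distribution//; exact: iY.
have E1 : \int[P]_w \Re (lin (-1 *: u) (X w)) = \int[P]_w \Re (lin u (X w)).
  rewrite /Rintegral; congr fine; rewrite [LHS]EY [RHS]EY.
  apply: eq_measure_integral => A mA _.
  rewrite [LHS](law _ mA) [RHS](law _ mA) varZ.
  by rewrite (_ : normc (-1) ^+ 2 = 1) ?mul1r// sqr_normc2/=; ring.
have E2 : \int[P]_w \Re (lin (-1 *: u) (X w)) = - \int[P]_w \Re (lin u (X w)).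
  transitivity (\int[P]_w (-1 * (Y u w : R))).
    by apply: eq_Rintegral => w _; rewrite linZ !mulN1r /Y; case: (lin _ _).
  by rewrite RintegralZl ?mulN1r//; exact: iY.
by have /eqP := etrans (esym E2) E1; rewrite eqNr => /eqP.
Qed.

Lemma cexpectation_lin u : E (fun w => lin u (X w)) = 0.
Proof.
rewrite cexpectationE mean_Re.
under eq_Rintegral do rewrite Im_lin.
by rewrite mean_Re.
Qed.

Lemma cLp1_lin2 u v : cLp P 1 (fun w => lin u (X w) * (lin v (X w))^*).
Proof.
by apply: cLpM; [exact: cLp2_lin|apply: cLp_conj; exact: cLp2_lin].
Qed.

Lemma cLp2_lin2 u v : cLp P 2 (fun w => lin u (X w) * (lin v (X w))^*).
Proof.
by apply: cLpM; [exact: cLp4_lin|apply: cLp_conj; exact: cLp4_lin].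
Qed.

Lemma cov_sesquilinear A : sesquilinear_form (cov A).
Proof. by split; [exact: covDl|exact: covDr|exact: covZl|exact: covZr]. Qed.

Let moment2' u : \int[P]_w (\Re (lin u (X w)) ^+ 2) = var u.
Proof. by rewrite /Rintegral moment2. Qed.

Let moment4' u : \int[P]_w (\Re (lin u (X w)) ^+ 4) = 3 * var u ^+ 2.
Proof. by rewrite /Rintegral moment4. Qed.

Let integrable2 u : P.-integrable setT (fun w => (\Re (lin u (X w)) ^+ 2)%:E).
Proof.
apply/integrableP; split.
  by apply/measurable_EFinP; apply: measurable_funX; exact: mRe.
under eq_integral do rewrite /= ger0_norm ?sqr_ge0//.
by rewrite moment2 ltry.
Qed.

(** On the diagonal, real and imaginary parts each contribute [var u], that is, half of [cov S u u];
    sesquilinearity does the rest. *)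
Lemma cexpectation_lin2 u v :
  E (fun w => lin u (X w) * (lin v (X w))^*) = cov S u v.
Proof.
apply: (@sesquilinear_eq _ _ (fun u v => E (fun w => lin u (X w) * (lin v (X w))^*))).
- split=> [u1 u2 v1|u1 v1 v2|a u1 v1|a u1 v1].
  + rewrite -cexpectationD; [|exact: cLp1_lin2|exact: cLp1_lin2].
    by apply: eq_cexpectation => w; rewrite linD mulrDl.
  + rewrite -cexpectationD; [|exact: cLp1_lin2|exact: cLp1_lin2].
    by apply: eq_cexpectation => w; rewrite linD rmorphD mulrDr.
  + rewrite -cexpectationZ; last exact: cLp1_lin2.
    by apply: eq_cexpectation => w; rewrite linZ mulrA.
  + rewrite -cexpectationZ; last exact: cLp1_lin2.
    by apply: eq_cexpectation => w; rewrite linZ rmorphM mulrCA.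
- exact: cov_sesquilinear.
- move=> {u v} u; rewrite -second_momentE cov_real; congr _%:C.
  rewrite /second_moment unlock -/(Rintegral _ _ _).
  under eq_Rintegral do rewrite sqr_normc2 Im_lin.
  rewrite RintegralD//; [|exact: integrable2|exact: integrable2].
  by rewrite !moment2' varZ sqr_normc2/= /var; field.
Qed.

Let fourth u : E (fun w => lin u (X w) * (lin u (X w))^* *
  (lin u (X w) * (lin u (X w))^*)) = 2 * cov S u u ^+ 2.
Proof.
have -> : E (fun w => lin u (X w) * (lin u (X w))^* *
    (lin u (X w) * (lin u (X w))^*)) =
    (\int[P]_w (normc (lin u (X w)) ^+ 4))%:C.
  rewrite cexpectationE; congr (_ +i* _).
    by apply: eq_Rintegral => w _; rewrite mul_conj_normc -rmorphM/= -exprD.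
  by rewrite /Rintegral integral0_eq// => w _; rewrite mul_conj_normc -rmorphM.
rewrite cov_real -rmorphXn -(rmorph_nat (real_complex R)) -rmorphM; congr _%:C.
pose y k w : R := \Re (lin (k *: u) (X w)).
(* The joint law of the real part a and the imaginary part b is not directly at hand, so (a^2 +
   b^2)^2 is written with fourth powers of a + b, a - b, a and b. Each of these is the real part of
   one functional, with index [1 - 'i], [1 + 'i], [1] or [- 'i] times [u]. *)
have E4 w : normc (lin u (X w)) ^+ 4 =
    6^-1 * (y (1 - 'i) w ^+ 4 + y (1 + 'i) w ^+ 4)
    + (2 / 3) * (y 1 w ^+ 4 + y (- 'i) w ^+ 4).
  rewrite (exprM _ 2 2) sqr_normc2 /y !linZ !ReM.
  by case: (lin u (X w)) => a b /=; field.
have i4 k : P.-integrable setT (EFin \o (fun w => y k w ^+ 4)) by exact: integrable4.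
have ii k l : P.-integrable setT (EFin \o (fun w => y k w ^+ 4 + y l w ^+ 4)).
  by have := integrableD measurableT (i4 k) (i4 l).
have iZ (c : R) k l :
    P.-integrable setT (EFin \o (fun w => c * (y k w ^+ 4 + y l w ^+ 4))).
  by have := integrableZl measurableT c (ii k l).
have RZ (c : R) k l : \int[P]_w (c * (y k w ^+ 4 + y l w ^+ 4)) =
    c * (3 * var (k *: u) ^+ 2 + 3 * var (l *: u) ^+ 2).
  by rewrite RintegralZl// RintegralD// !moment4'.
have vm : var ((1 - 'i) *: u) = 2 * var u by rewrite varZ sqr_normc2/=; ring.
have vp : var ((1 + 'i) *: u) = 2 * var u by rewrite varZ sqr_normc2/=; ring.
have v1 : var (1 *: u) = var u by rewrite scale1r.
have vi : var (- 'i *: u) = var u by rewrite varZ sqr_normc2/=; ring.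
have -> : \Re (cov S u u) = 2 * var u by rewrite /var; field.
under eq_Rintegral do rewrite E4.
rewrite RintegralD; [|by []|exact: iZ|exact: iZ].
clear i4 ii E4; clearbody y; rewrite (RZ _ (1 - 'i)) (RZ _ 1) vm vp v1 vi.
by move: (var u) => v; field.
Qed.

Lemma cexpectation_lin4 a b c e :
  E (fun w => lin a (X w) * (lin b (X w))^* * (lin c (X w) * (lin e (X w))^*)) =
  cov S a b * cov S c e + cov S a e * cov S c b.
Proof.
have L1 a' b' c' e' : cLp P 1 (fun w => lin a' (X w) * (lin b' (X w))^* *
    (lin c' (X w) * (lin e' (X w))^*)).
  by apply: cLpM; exact: cLp2_lin2.
apply: (@quartic_of_diag _ _ (fun a b c e =>
  E (fun w => lin a (X w) * (lin b (X w))^* * (lin c (X w) * (lin e (X w))^*)))).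
- exact: cov_sesquilinear.
- move=> {a b c e} a b c e; apply: eq_cexpectation => w.
  by rewrite mulrACA [RHS]mulrACA [lin c _ * _]mulrC.
- move=> {a b c e} a b c e; apply: eq_cexpectation => w.
  by rewrite mulrACA [RHS]mulrACA [(lin e _)^* * _]mulrC.
- move=> {a b c e} c e; split=> [a a' b|a b b'|k a b|k a b].
  + rewrite -cexpectationD//.
    by apply: eq_cexpectation => w; rewrite linD !mulrDl.
  + rewrite -cexpectationD//.
    by apply: eq_cexpectation => w; rewrite linD rmorphD mulrDr mulrDl.
  + rewrite -cexpectationZ//.
    by apply: eq_cexpectation => w; rewrite linZ -!mulrA.
  + rewrite -cexpectationZ//.
    by apply: eq_cexpectation => w; rewrite linZ rmorphM !mulrA (mulrC (lin a _)).
- exact: fourth.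
Qed.

End ComplexNormal.

(** * Independent additive noise *)

Section SourceMeasurability.
Context d (T : measurableType d) (R : realType) (M : nat).

Lemma cmeasurable_sigma_of (X : T -> 'cV[R[i]]_M) m :
  cmeasurable ((fun w => X w m 0) : g_sigma_algebraType (sigma_of X) -> R[i]).
Proof.
(* Two inclusions are needed: [sigma_of X] is already generated, and [g_sigma_algebraType] generates
   once more. *)
split=> _ A mA; rewrite setTI; do 2 apply: sub_sigma_algebra.
  by exists m, A; split => //; left.
by exists m, A; split => //; right.
Qed.

Lemma sigma_of_measurable (X : T -> 'cV[R[i]]_M) :
  (forall m, cmeasurable (fun w => X w m 0)) -> sigma_of X `<=` measurable.
Proof.
move=> mX; apply: smallest_sub; first exact: sigma_algebra_measurable.
move=> _ [m [A [mA [->|->]]]]; rewrite -[X in measurable X]setTI.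
  exact: (mX m).1.
exact: (mX m).2.
Qed.

End SourceMeasurability.

(** * White noise with weights free of it *)

Section WhiteNoise.
Context d (T : measurableType d) (R : realType) (P : probability T R).
Context {I : finType} {M : nat}.
Variable X : I -> T -> 'cV[R[i]]_M.
Hypothesis mX : forall j m, cmeasurable (fun w => X j w m 0).
Hypothesis indepX : mutually_independent P X.

Local Notation E := (cexpectation P).

(** Measurability for the sigma-algebra of all sources but [s]. It allows any measurable function of
    these sources, in particular the square roots in the distortion amplitudes. *)
Definition free_of (s : I) (f : T -> R[i]) : Prop :=
  cmeasurable (f : g_sigma_algebraType (others X s) -> R[i]).

Lemma free_of_cst s z : free_of s (fun=> z).
Proof. exact: cmeasurable_cst. Qed.

Lemma free_ofD s f g : free_of s f -> free_of s g -> free_of s (fun w => f w + g w).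
Proof. exact: cmeasurableD. Qed.

Lemma free_ofM s f g : free_of s f -> free_of s g -> free_of s (fun w => f w * g w).
Proof. exact: cmeasurableM. Qed.

Lemma free_of_conj s f : free_of s f -> free_of s (fun w => (f w)^*).
Proof. exact: cmeasurable_conj. Qed.

Lemma free_of_sum s (J : Type) (r : seq J) (F : J -> T -> R[i]) :
  (forall j, free_of s (F j)) -> free_of s (fun w => \sum_(j <- r) F j w).
Proof. exact: cmeasurable_sum. Qed.

Let msX j : sigma_of (X j) `<=` measurable.
Proof. exact: sigma_of_measurable. Qed.

Lemma free_of_coord s j m : j != s -> free_of s (fun w => X j w m 0).
Proof.
move=> js; have [f1 f2] := cmeasurable_sigma_of (X j) m.
have sub : <<s sigma_of (X j) >> `<=` <<s others X s >>.
  by apply: sub_smallest2r; [exact: smallest_sigma_algebra|exact: sub_others].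
by split => _ A mA; apply: sub; [exact: f1|exact: f2].
Qed.

Lemma free_of_lin s j u : j != s -> free_of s (fun w => lin u (X j w)).
Proof.
move=> js; rewrite /free_of; under eq_fun do rewrite linE.
apply: cmeasurable_sum => m; apply: cmeasurableM; first exact: cmeasurable_cst.
exact: free_of_coord.
Qed.

Lemma cmeasurable_self_lin s u : cmeasurable
  ((fun w => lin u (X s w)) : g_sigma_algebraType (sigma_of (X s)) -> R[i]).
Proof.
under eq_fun do rewrite linE.
apply: cmeasurable_sum => m; apply: cmeasurableM; first exact: cmeasurable_cst.
exact: cmeasurable_sigma_of.
Qed.

Let indep_s s A B : <<s others X s >> A -> <<s sigma_of (X s) >> B ->
  P (A `&` B) = (P A * P B)%E.
Proof.
move=> sA sB; apply: (indep_others msX indepX sA).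
by move: B sB; apply: smallest_sub => //; exact: smallest_sigma_algebra.
Qed.

Lemma cLp_free_mul s p f (g : T -> R[i]) : free_of s f ->
  cmeasurable (g : g_sigma_algebraType (sigma_of (X s)) -> R[i]) ->
  cLp P p f -> cLp P p g -> cLp P p (fun w => f w * g w).
Proof.
by apply: cLp_indepM; [exact: others_measurable|exact: msX|exact: indep_s].
Qed.

Lemma cexpectation_free_mul s f (g : T -> R[i]) : free_of s f ->
  cmeasurable (g : g_sigma_algebraType (sigma_of (X s)) -> R[i]) ->
  cLp P 1 f -> cLp P 1 g -> E (fun w => f w * g w) = E f * E g.
Proof.
by apply: cexpectation_indepM; [exact: others_measurable|exact: msX|exact: indep_s].
Qed.

Variables (s : I) (v : R).
Hypothesis v_ge0 : 0 <= v.
Hypothesis Xs_CN : is_CN P v%:C%:M (X s).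

Let psd_v : hermitian_psd (v%:C%:M : 'M[R[i]]_M).
Proof.
split.
  apply/is_hermitianmxP; rewrite expr0 scale1r tr_scalar_mx map_scalar_mx/=.
  by rewrite conj_realc.
move=> x; rewrite mul_mx_scalar -scalemxAl mxE mulr_ge0 ?ler0c// mxE.
by apply: sumr_ge0 => j _; rewrite !mxE mulrC mul_conjC_ge0.
Qed.

Let coordE m w : X s w m 0 = lin (delta_mx 0 m) (X s w).
Proof. by rewrite /lin -rowE mxE. Qed.

Lemma cLp4_noise m : cLp P 4 (fun w => X s w m 0).
Proof. by under eq_fun do rewrite coordE; exact: cLp4_lin psd_v Xs_CN _. Qed.

Let cLp2_noise m : cLp P 2 (fun w => X s w m 0).
Proof. by apply: (@cLpW _ _ _ _ 2); exact: cLp4_noise. Qed.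

Let cLp1_noise m : cLp P 1 (fun w => X s w m 0).
Proof. by apply: (@cLpW _ _ _ _ 1); exact: cLp2_noise. Qed.

Let cexpectation_noise m : E (fun w => X s w m 0) = 0.
Proof.
rewrite -(cexpectation_lin psd_v Xs_CN (delta_mx 0 m)).
by apply: eq_cexpectation => w; rewrite coordE.
Qed.

Let cexpectation_noise2 m l :
  E (fun w => X s w m 0 * (X s w l 0)^*) = v%:C * (m == l)%:R.
Proof.
transitivity (cov v%:C%:M (delta_mx 0 m : 'rV_M) (delta_mx 0 l)).
  rewrite -(cexpectation_lin2 psd_v Xs_CN).
  by apply: eq_cexpectation => w; rewrite !coordE.
rewrite /cov mul_mx_scalar -scalemxAl mxE -rowE !mxE/=.
by rewrite conjC_nat.
Qed.

Let self m := cmeasurable_sigma_of (X s) m.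

Variables (a : T -> R[i]) (W : 'I_M -> T -> R[i]).
Hypotheses (free_a : free_of s a) (free_W : forall m, free_of s (W m)).

Hypotheses (L2a : cLp P 2 a) (L2W : forall m, cLp P 2 (W m)).

Let L1a : cLp P 1 a. Proof. exact: (@cLpW _ _ _ _ 1). Qed.
Let L1W m : cLp P 1 (W m). Proof. exact: (@cLpW _ _ _ _ 1). Qed.

Lemma cexpectation_noise_add :
  E (fun w => a w + \sum_m W m w * X s w m 0) = E a.
Proof.
have L1WX m : cLp P 1 (fun w => W m w * X s w m 0).
  exact: cLp_free_mul (free_W m) (self m) (L1W m) (cLp1_noise m).
rewrite cexpectationD//; last exact: cLp_sum.
rewrite cexpectation_sum// big1 ?addr0// => m _.
by rewrite (cexpectation_free_mul (free_W m) (self m))// cexpectation_noise mulr0.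
Qed.

(** Every product of weights leaves the expectation as a single free factor, so only second-order
    statistics of [X s] enter: its zero mean removes the cross terms with [a], and its scalar
    covariance removes the pairs of distinct coordinates. *)
Lemma energy_noise_add :
  E (fun w => (a w + \sum_m W m w * X s w m 0) *
              (a w + \sum_m W m w * X s w m 0)^*) =
  E (fun w => a w * (a w)^*) + v%:C * \sum_m E (fun w => W m w * (W m w)^*).
Proof.
pose N w := \sum_m W m w * X s w m 0.
have L2N : cLp P 2 N.
  apply: cLp_sum => m.
  exact: cLp_free_mul (free_W m) (self m) (L2W m) (cLp2_noise m).
have L1 f g : cLp P 2 f -> cLp P 2 g -> cLp P 1 (fun w => f w * (g w)^*).
  by move=> Lf Lg; apply: cLpM => //; exact: cLp_conj.
have Na : E (fun w => N w * (a w)^*) = 0.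
  have free_m m : free_of s (fun w => W m w * (a w)^*).
    by apply: free_ofM => //; exact: free_of_conj.
  have L m : cLp P 1 (fun w => W m w * (a w)^* * X s w m 0).
    by apply: (cLp_free_mul (free_m m) (self m)) => //; exact: L1.
  transitivity (E (fun w => \sum_m W m w * (a w)^* * X s w m 0)).
    apply: eq_cexpectation => w; rewrite mulr_suml; apply: eq_bigr => m _.
    by rewrite mulrAC.
  rewrite cexpectation_sum// big1// => m _.
  rewrite (cexpectation_free_mul (free_m m) (self m))//; last exact: L1.
  by rewrite cexpectation_noise mulr0.
have aN : E (fun w => a w * (N w)^*) = 0.
  rewrite -[RHS]conjC0 -Na -[RHS]cexpectation_conj; last exact: L1.
  by apply: eq_cexpectation => w; rewrite [RHS]rmorphM/= conjCK mulrC.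
have NN : E (fun w => N w * (N w)^*) = v%:C * \sum_m E (fun w => W m w * (W m w)^*).
  have free_ml m l : free_of s (fun w => W m w * (W l w)^*).
    by apply: free_ofM => //; exact: free_of_conj.
  have self_ml m l : cmeasurable ((fun w => X s w m 0 * (X s w l 0)^*)
      : g_sigma_algebraType (sigma_of (X s)) -> R[i]).
    by apply: cmeasurableM => //; exact: cmeasurable_conj.
  have L m l : cLp P 1 (fun w => W m w * (W l w)^* * (X s w m 0 * (X s w l 0)^*)).
    by apply: (cLp_free_mul (free_ml m l) (self_ml m l)); exact: L1.
  transitivity (E (fun w => \sum_m \sum_l
      W m w * (W l w)^* * (X s w m 0 * (X s w l 0)^*))).
    apply: eq_cexpectation => w; rewrite mulr_suml; apply: eq_bigr => m _.
    rewrite rmorph_sum mulr_sumr; apply: eq_bigr => l _.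
    by rewrite rmorphM mulrACA.
  rewrite cexpectation_sum; last by move=> m; exact: cLp_sum.
  rewrite mulr_sumr; apply: eq_bigr => m _.
  rewrite cexpectation_sum// (bigD1 m)//= big1 ?addr0 => [|l lm].
    rewrite (cexpectation_free_mul (free_ml m m) (self_ml m m)); [|exact: L1..].
    by rewrite cexpectation_noise2 eqxx mulr1 mulrC.
  rewrite (cexpectation_free_mul (free_ml m l) (self_ml m l)); [|exact: L1..].
  by rewrite cexpectation_noise2 eq_sym (negbTE lm) mulr0 mulr0.
transitivity (E (fun w => (a w * (a w)^* + N w * (a w)^*) +
    (a w * (N w)^* + N w * (N w)^*))).
  by apply: eq_cexpectation => w; rewrite rmorphD -/(N w) mulrDr !mulrDl.
have La := L1 _ _ L2a L2a; have LNa := L1 _ _ L2N L2a.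
have LaN := L1 _ _ L2a L2N; have LNN := L1 _ _ L2N L2N.
rewrite cexpectationD; [|exact: cLpD|exact: cLpD].
by rewrite cexpectationD// cexpectationD// Na aN NN addr0 add0r.
Qed.

End WhiteNoise.

(** * The covariance of the pilot observation *)

Section MatrixFacts.
Context {R : realType} {M K : nat}.
Implicit Types (A B S : 'M[R[i]]_M).

Lemma cov_row S A B a b :
  cov S (row a A) (row b B) = (A *m S *m B^t*) a b.
Proof.
rewrite /cov -row_mul !mxE; apply: eq_bigr => j _.
by rewrite !mxE.
Qed.

Lemma map_trmx_mul m p q (A : 'M[R[i]]_(m, p)) (B : 'M[R[i]]_(p, q)) :
  (A *m B)^t* = B^t* *m A^t*.
Proof. by rewrite trmx_mul map_mxM. Qed.

Lemma trmxC1 : (1%:M : 'M[R[i]]_M)^t* = 1%:M.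
Proof. by rewrite trmx1 map_mx1. Qed.

Lemma hermitian_trmxC S : hermitian_psd S -> S^t* = S.
Proof. by move=> [/is_hermitianmxP + _]; rewrite expr0 scale1r => <-. Qed.

Lemma trmxC_entry A a b : (A^t* ) a b = (A b a)^*.
Proof. by rewrite !mxE. Qed.

Lemma hermitian_entry S a b : S^t* = S -> (S a b)^* = S b a.
Proof. by move=> {2}<-; rewrite !mxE. Qed.

Lemma psd_diag_ge0 S m : hermitian_psd S -> 0 <= S m m.
Proof.
move=> [_ /(_ (delta_mx m 0))]; congr (0 <= _).
rewrite trmx_delta map_delta_mx -rowE.
rewrite mxE (bigD1 m)//= big1 => [|j jm]; rewrite !mxE ?eqxx ?mulr1 ?addr0//.
by rewrite (negbTE jm) mulr0.
Qed.

Variables (tau : nat) (pil : 'I_K -> R) (sigma2 : R) (eps : 'I_M -> R).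
Variable Rc : 'I_K -> 'M[R[i]]_M.
Hypothesis Rc_psd : forall i, hermitian_psd (Rc i).
Local Notation Psi := (Psi tau pil sigma2 eps Rc).

(** The mean power of pilot noise plus pilot distortion at antenna [m], before the scaling by 1 /
    (tau pil_k); it is the diagonal correction in [Psi]. *)
Definition noise_level m : R[i] :=
  sigma2%:C + \sum_j (pil j)%:C * ((eps m)%:C ^+ 2 * Rc j m m).

Lemma PsiE k :
  Psi k = Rc k + ((tau%:R * pil k)^-1)%:C *: diag_mx (\row_m noise_level m).
Proof.
congr (_ + _ *: _); apply/matrixP => a b.
rewrite !mxE summxE /noise_level mulrnDl -sumrMnl; congr (_ + _).
apply: eq_bigr => j _; rewrite mxE /Deps mul_mx_diag mxE mul_diag_mx !mxE.
by case: eqP => [->|_]; rewrite ?mulr1n ?mulr0n ?mulr0 ?mul0r ?mulr0//; ring.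
Qed.

Lemma noise_level_real m : (noise_level m)^* = noise_level m.
Proof.
apply: conj_Creal; rewrite rpredD ?complex_real//; apply: rpred_sum => j _.
rewrite !rpredM ?rpredX ?complex_real//.
by rewrite ger0_real// psd_diag_ge0.
Qed.

Lemma Psi_trmxC k : (Psi k)^t* = Psi k.
Proof.
rewrite PsiE linearD/= map_mxD hermitian_trmxC// linearZ/= map_mxZ/=.
rewrite conj_realc tr_diag_mx map_diag_mx.
by congr (_ + _ *: diag_mx _); apply/rowP => m; rewrite !mxE/= noise_level_real.
Qed.

Lemma mul_diag_entry A B (x : 'I_M -> R[i]) a b :
  (A *m diag_mx (\row_m x m) *m B) a b = \sum_l x l * (A a l * B l b).
Proof.
rewrite mul_mx_diag mxE; apply: eq_bigr => l _.
by rewrite !mxE; ring.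
Qed.

Lemma Psi_entry k A B a b : (A *m Psi k *m B) a b =
  (A *m Rc k *m B) a b +
  ((tau%:R * pil k)^-1)%:C * \sum_l noise_level l * (A a l * B l b).
Proof.
by rewrite PsiE mulmxDr mulmxDl mxE -scalemxAr -scalemxAl [X in _ + X]mxE mul_diag_entry.
Qed.

Lemma tr_Psi k A : \tr (Psi k *m A) = \tr (Rc k *m A) +
  ((tau%:R * pil k)^-1)%:C * \sum_l noise_level l * A l l.
Proof.
rewrite PsiE mulmxDl mxtraceD -scalemxAl mxtraceZ; congr (_ + _ * _).
by rewrite mul_diag_mx; apply: eq_bigr => l _; rewrite !mxE.
Qed.

Hypotheses (tau_gt0 : (0 < tau)%N) (pil_gt0 : forall i, 0 < pil i).
Hypotheses (sigma2_gt0 : 0 < sigma2) (eps_ge0 : forall m, 0 <= eps m).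

Lemma noise_level_gt0 m : 0 < noise_level m.
Proof.
rewrite ltr_wpDr ?ltcR//; apply: sumr_ge0 => j _.
apply: mulr_ge0; first by rewrite ler0c ltW.
by apply: mulr_ge0; [rewrite exprn_ge0 ?ler0c|exact: psd_diag_ge0].
Qed.

(** Positive definiteness: a nonzero [u] with [u *m Psi k = 0] would have zero quadratic form, while
    the strictly positive noise levels make it positive. *)
Lemma Psi_unit k : Psi k \in unitmx.
Proof.
rewrite unitmxE unitfE; apply/negP => /det0P[u u0 uPsi].
(* [Psi_entry] is stated for square factors, so the row [u] is repeated to form one. *)
pose U : 'M[R[i]]_M := \matrix_(a < M) u.
have := Psi_entry k U (U^t* ).
have [m um] : exists m, u 0 m != 0.
  apply/existsP; move: u0; apply: contraR; rewrite negb_exists => /forallP u0.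
  by apply/eqP/rowP => m; rewrite mxE; apply/eqP; have := u0 m; rewrite negbK.
move=> /(_ m m).
have rowu (X : 'M[R[i]]_M) : (U *m X *m U^t*) m m = cov X u u.
  by rewrite -cov_row !rowK.
have c0 : 0 < ((tau%:R * pil k)^-1)%:C :> R[i].
  by rewrite ltcR invr_gt0 mulr_gt0 ?ltr0n.
rewrite !rowu {1}/cov uPsi mul0mx mxE => /esym/eqP.
rewrite gt_eqF// ltr_wpDl ?cov_ge0// mulr_gt0//.
rewrite (bigD1 m)//= ltr_wpDr//.
  apply: sumr_ge0 => l _; rewrite mulr_ge0 ?(ltW (noise_level_gt0 l))//.
  by rewrite !mxE mul_conjC_ge0.
by rewrite mulr_gt0 ?noise_level_gt0// !mxE mul_conjC_gt0.
Qed.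

Lemma tr_Deps2 (X : 'M[R[i]]_M) :
  \tr (Deps eps ^+ 2 *m X) = \sum_m (eps m)%:C ^+ 2 * X m m.
Proof.
rewrite expr2 -mulmxE /Deps mulmx_diag mul_diag_mx.
by apply: eq_bigr => m _; rewrite !mxE expr2.
Qed.

Lemma abs2mx_diagpart (X : 'M[R[i]]_M) m :
  abs2mx (diagpart X) m m = X m m * (X m m)^*.
Proof. by rewrite !mxE eqxx mulr1n normCK. Qed.

End MatrixFacts.

(** * Moments of the combined signals *)

Section UplinkMoments.
Context (R : realType) (d : measure_display) (T : measurableType d).
Context (P : probability T R) (M K : nat).
Variables (tau : nat) (pil rho : 'I_K -> R) (sigma2 : R) (eps : 'I_M -> R).
Variable Rc : 'I_K -> 'M[R[i]]_M.
Variables (h : 'I_K -> T -> 'cV[R[i]]_M) (nbar rbar n r : T -> 'cV[R[i]]_M).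
Hypotheses (pil_ge0 : forall i, 0 <= pil i) (rho_ge0 : forall i, 0 <= rho i).
Hypothesis sigma2_ge0 : 0 <= sigma2.
Hypothesis Rc_psd : forall i, hermitian_psd (Rc i).
Hypothesis h_CN : forall i, is_CN P (Rc i) (h i).
Hypothesis nbar_CN : is_CN P sigma2%:C%:M nbar.
Hypothesis rbar_CN : is_CN P 1%:M rbar.
Hypothesis n_CN : is_CN P sigma2%:C%:M n.
Hypothesis r_CN : is_CN P 1%:M r.

Let src := sources h nbar rbar n r.
Hypothesis indep : mutually_independent P src.

Local Notation E := (cexpectation P).
Local Notation free := (free_of src).

Let s_nbar : 'I_K + 'I_4 := inr (@Ordinal 4 0 isT).
Let s_rbar : 'I_K + 'I_4 := inr (@Ordinal 4 1 isT).
Let s_n : 'I_K + 'I_4 := inr (@Ordinal 4 2 isT).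
Let s_r : 'I_K + 'I_4 := inr (@Ordinal 4 3 isT).

(** Complex valued, unlike [second_moment], so that energies combine with matrix entries without
    casts. *)
Definition energy (f : T -> R[i]) : R[i] := E (fun w => f w * (f w)^*).

Lemma eq_energy f g : f =1 g -> energy f = energy g.
Proof. by move=> /funext ->. Qed.

Lemma energy_conj f : energy (fun w => (f w)^*) = energy f.
Proof. by apply: eq_cexpectation => w; rewrite conjCK mulrC. Qed.

Lemma energyZ (z : R[i]) f : cLp P 2 f ->
  energy (fun w => z * f w) = z * z^* * energy f.
Proof.
move=> Lf; rewrite /energy -cexpectationZ.
  by apply: eq_cexpectation => w; rewrite rmorphM mulrACA.
by apply: cLpM => //; exact: cLp_conj.
Qed.

Let mX j m : cmeasurable (fun w => src j w m 0).
Proof.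
case: j => [i|[[|[|[|[|j]]]] lt_j]] //=; try exact: cmeasurable_coord nbar_CN _.
- exact: cmeasurable_coord (h_CN i) _.
- exact: cmeasurable_coord rbar_CN _.
- exact: cmeasurable_coord n_CN _.
- exact: cmeasurable_coord r_CN _.
Qed.

Let rbar_CN' : is_CN P 1%:C%:M (src s_rbar). Proof. exact: rbar_CN. Qed.
Let r_CN' : is_CN P 1%:C%:M (src s_r). Proof. exact: r_CN. Qed.

Lemma coord_lin (x : 'cV[R[i]]_M) m : x m 0 = lin (delta_mx 0 m) x.
Proof. by rewrite /lin -rowE mxE. Qed.

Lemma cLp4_chan i m : cLp P 4 (fun w => h i w m 0).
Proof.
by under eq_fun do rewrite coord_lin; exact: cLp4_lin (Rc_psd i) (h_CN i) _.
Qed.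

Lemma free_chan j i m : free (inr j) (fun w => h i w m 0).
Proof. exact: (@free_of_coord _ _ _ _ _ src (inr j) (inl i)). Qed.

Lemma cexpectation_chan2 i u v :
  E (fun w => lin u (h i w) * (lin v (h i w))^*) = cov (Rc i) u v.
Proof. exact: (cexpectation_lin2 (Rc_psd i) (h_CN i)). Qed.

(** For [i = k] this is the Gaussian formula with its two pairings; for distinct users independence
    leaves only the pairing within each channel. The indicator lets both cases be summed
    together. *)
Lemma cexpectation_chan4 k i a b c e :
  E (fun w => lin a (h k w) * (lin b (h k w))^* *
              (lin c (h i w) * (lin e (h i w))^*)) =
  cov (Rc k) a b * cov (Rc i) c e +
  (i == k)%:R * (cov (Rc i) a e * cov (Rc i) c b).
Proof.
have [->|ik] := eqVneq i k; first by rewrite mul1r (cexpectation_lin4 (Rc_psd k) (h_CN k)).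
rewrite mul0r addr0 -(cexpectation_chan2 k) -(cexpectation_chan2 i).
have ki : inl k != inl i :> 'I_K + 'I_4 by rewrite eq_sym.
apply: (@cexpectation_free_mul _ _ _ _ _ _ src mX indep (inl i)).
- by apply: free_ofM; [|apply: free_of_conj]; exact: (@free_of_lin _ _ _ _ _ src _ (inl k)).
- by apply: cmeasurableM; [|apply: cmeasurable_conj];
    exact: (cmeasurable_self_lin src (inl i)).
- exact: (cLp1_lin2 (Rc_psd k) (h_CN k)).
- exact: (cLp1_lin2 (Rc_psd i) (h_CN i)).
Qed.

(** * Amplitudes of the hardware distortion *)

Section Amplitude.
Variable p : 'I_K -> R.
Hypothesis p_ge0 : forall i, 0 <= p i.

Definition amp m w : R[i] := sqrtC (\sum_i (p i)%:C * `|h i w m 0| ^+ 2).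

Let power m w : R := \sum_i p i * normc (h i w m 0) ^+ 2.

Let power_ge0 m w : 0 <= power m w.
Proof. by apply: sumr_ge0 => i _; rewrite mulr_ge0// sqr_ge0. Qed.

Let ampE m w : amp m w = (Num.sqrt (power m w))%:C.
Proof.
rewrite -sqrtC_realc//; congr sqrtC; rewrite rmorph_sum; apply: eq_bigr => i _.
by rewrite rmorphM rmorphXn.
Qed.

Lemma amp_sqr m w : amp m w * (amp m w)^* =
  \sum_i (p i)%:C * (h i w m 0 * (h i w m 0)^*).
Proof.
rewrite ampE conj_realc -rmorphM -expr2 sqr_sqrtr// rmorph_sum.
by apply: eq_bigr => i _; rewrite rmorphM mul_conj_normc.
Qed.

Lemma free_amp j m : free (inr j) (amp m).
Proof.
have -> : amp m = (fun w => (Num.sqrt (power m w))%:C).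
  by apply/funext => w; exact: ampE.
apply/cmeasurable_realP.
apply: (measurable_comp measurableT) => //=.
  by apply: continuous_measurable_fun; exact: sqrt_continuous.
apply: measurable_sum => i; apply: measurable_funM; first exact: measurable_cst.
by apply: measurable_funX; apply: measurable_normc; exact: free_chan.
Qed.

(** The fourth moment of the amplitude is the second moment of its square, which is polynomial in
    the channels. *)
Lemma cLp4_amp m : cLp P 4 (amp m).
Proof.
have [_ I2] : cLp P 2 (fun w => amp m w * (amp m w)^*).
  under eq_fun do rewrite amp_sqr.
  apply: cLp_sum => i; apply: cLpZ.
  by apply: cLpM; [|apply: cLp_conj]; exact: cLp4_chan.
split; last first.
  apply: eq_integrable I2 => // w _.
  by rewrite mul_conj_normc normc_real ger0_norm ?sqr_ge0// -exprM.
(* Plain measurability is deduced from measurability for a smaller sigma-algebra, here that of the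
   sources other than [nbar]. *)
apply: sub_cmeasurable (free_amp (@Ordinal 4 0 isT) m).
by apply: others_measurable => j; apply: sigma_of_measurable => l; exact: mX.
Qed.

Lemma distortionE g s m w : (forall i, g i = h i w) ->
  distortion eps p g s m 0 = (eps m)%:C * amp m w * s m 0.
Proof.
move=> gE; rewrite /distortion.
have -> : \sum_i (p i)%:C *: Dchan (g i) =
    diag_mx (\row_l \sum_i (p i)%:C * `|h i w l 0| ^+ 2).
  apply/matrixP => a b; rewrite summxE !mxE -sumrMnl; apply: eq_bigr => i _.
  by rewrite !mxE gE mulrnAr.
have -> : map_mx sqrtC (diag_mx (\row_l \sum_i (p i)%:C * `|h i w l 0| ^+ 2)) =
    diag_mx (\row_l amp l w).
  apply/matrixP => a b; rewrite !mxE; case: eqP => _; rewrite ?mulr1n//.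
  by rewrite !mulr0n sqrtC0.
by rewrite /Deps mulmx_diag mul_diag_mx !mxE.
Qed.

(** The square root disappears pointwise, before any expectation is taken, so [f] may itself depend
    on the channels. *)
Lemma energy_amp_mul m f : cLp P 4 f ->
  energy (fun w => f w * amp m w) = \sum_i (p i)%:C * energy (fun w => f w * h i w m 0).
Proof.
move=> Lf.
have L i : cLp P 1 (fun w => f w * h i w m 0 * (f w * h i w m 0)^*).
  by apply: cLpM; [|apply: cLp_conj]; apply: cLpM => //; exact: cLp4_chan.
rewrite /energy; under [RHS]eq_bigr do rewrite -cexpectationZ//.
rewrite -cexpectation_sum; last by move=> i; exact: cLpZ.
apply: eq_cexpectation => w; rewrite rmorphM/= mulrACA amp_sqr mulr_sumr.
by apply: eq_bigr => i _; rewrite [in RHS]rmorphM/=; ring.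
Qed.

End Amplitude.

Let c k : R[i] := ((Num.sqrt (tau%:R * pil k))^-1)%:C.
Let z k w := pilot_obs tau pil eps (fun i => h i w) (nbar w) (rbar w) k.

Let zE k w l : z k w l 0 =
  h k w l 0 + c k * nbar w l 0 + c k * (eps l)%:C * amp pil l w * rbar w l 0.
Proof.
rewrite /z /pilot_obs mxE [X in _ + X]mxE [X in _ * X]mxE.
by rewrite (@distortionE pil (fun i => h i w) _ _ w)// -/(c k) mulrDr !mulrA addrA.
Qed.

Let c_conj k : (c k)^* = c k. Proof. exact: conj_realc. Qed.

Let c_sqr k : c k * c k = ((tau%:R * pil k)^-1)%:C.
Proof.
rewrite /c -rmorphM -expr2 exprVn sqr_sqrtr//.
by rewrite mulr_ge0.
Qed.

Let Lnbar := cLp4_noise (s := s_nbar) sigma2_ge0 nbar_CN.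
Let Lrbar := cLp4_noise (s := s_rbar) ler01 rbar_CN'.

(** * Combinations of the pilot observation with random weights *)

Section Observation.
Variables (k : 'I_K) (b : 'I_M -> T -> R[i]).
Hypotheses (free_b0 : forall l, free s_nbar (b l))
           (free_b1 : forall l, free s_rbar (b l)).
Hypothesis L4b : forall l, cLp P 4 (b l).

Let bh w := \sum_l b l w * h k w l 0.
Let b0 l w := c k * b l w.
Let bn w := bh w + \sum_l b0 l w * nbar w l 0.
Let b1 l w := c k * (eps l)%:C * (b l w * amp pil l w).

Let decomp w : \sum_l b l w * z k w l 0 = bn w + \sum_l b1 l w * rbar w l 0.
Proof.
rewrite /bn /bh -!big_split/=; apply: eq_bigr => l _.
by rewrite zE /b0 /b1; ring.
Qed.

Let L2bh : cLp P 2 bh.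
Proof. by apply: cLp_sum => l; apply: cLpM => //; exact: cLp4_chan. Qed.

Let free_bh : free s_nbar bh.
Proof. by apply: free_of_sum => l; apply: free_ofM => //; exact: free_chan. Qed.

Let L2b0 l : cLp P 2 (b0 l).
Proof. by apply: cLpZ; exact: (@cLpW _ _ _ _ 2). Qed.

Let free_b0' l : free s_nbar (b0 l).
Proof. by apply: free_ofM => //; exact: free_of_cst. Qed.

Let free_bn : free s_rbar bn.
Proof.
apply: free_ofD; first by apply: free_of_sum => l; apply: free_ofM => //; exact: free_chan.
apply: free_of_sum => l; apply: free_ofM; last exact: (@free_of_coord _ _ _ _ _ src _ s_nbar).
by apply: free_ofM => //; exact: free_of_cst.
Qed.

Let L2bn : cLp P 2 bn.
Proof.
apply: cLpD => //; apply: cLp_sum => l; apply: cLpM; last exact: Lnbar.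
exact: cLpZ.
Qed.

Let free_b1' l : free s_rbar (b1 l).
Proof.
apply: free_ofM; first exact: free_of_cst.
by apply: free_ofM => //; exact: free_amp.
Qed.

Let L2ba l : cLp P 2 (fun w => b l w * amp pil l w).
Proof. by apply: cLpM => //; exact: cLp4_amp. Qed.

Let L2b1 l : cLp P 2 (b1 l). Proof. exact: cLpZ. Qed.

Lemma cexpectation_obs :
  E (fun w => \sum_l b l w * z k w l 0) = E (fun w => \sum_l b l w * h k w l 0).
Proof.
under eq_cexpectation do rewrite decomp.
rewrite (cexpectation_noise_add mX indep ler01 rbar_CN' free_b1')//.
exact: (cexpectation_noise_add mX indep (s := s_nbar) sigma2_ge0 nbar_CN).
Qed.

(** [rbar] is removed while [nbar] still belongs to the free term [bn], then [nbar] is removed from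
    [bn]. The weights are random so that one formula serves the constant rows of the filter, the
    functionals of h_i in v^H h_i, and the products with a coordinate of h_i. *)
Lemma energy_obs :
  energy (fun w => \sum_l b l w * z k w l 0) =
  energy (fun w => \sum_l b l w * h k w l 0) +
  ((tau%:R * pil k)^-1)%:C * (sigma2%:C * \sum_l energy (b l) +
    \sum_l (eps l)%:C ^+ 2 *
      \sum_j (pil j)%:C * energy (fun w => b l w * h j w l 0)).
Proof.
rewrite (eq_energy decomp).
rewrite [LHS](energy_noise_add mX indep ler01 rbar_CN' free_bn free_b1')//.
rewrite (_ : E _ = energy bh + sigma2%:C * \sum_l energy (b0 l)); last first.
  exact: (energy_noise_add mX indep (s := s_nbar) sigma2_ge0 nbar_CN).
rewrite mul1r -addrA mulrDr; congr (_ + (_ + _)).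
  rewrite mulrCA; congr (_ * _); rewrite mulr_sumr; apply: eq_bigr => l _.
  rewrite energyZ; last exact: (@cLpW _ _ _ _ 2).
  by rewrite c_conj c_sqr.
rewrite mulr_sumr; apply: eq_bigr => l _.
rewrite -[E _]/(energy (b1 l)) /b1 energyZ// energy_amp_mul// mulrA -c_sqr rmorphM/= c_conj.
rewrite conj_realc.
by congr (_ * _); ring.
Qed.

End Observation.

Lemma cLp4_obs k l : cLp P 4 (fun w => z k w l 0).
Proof.
under eq_fun do rewrite zE.
apply: cLpD; first by apply: cLpD; [exact: cLp4_chan|apply: cLpZ; exact: Lnbar].
apply: (cLp_free_mul mX indep (s := s_rbar)).
- by apply: free_ofM; [exact: free_of_cst|exact: free_amp].
- exact: (cmeasurable_sigma_of (src s_rbar)).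
- by apply: cLpZ; exact: cLp4_amp.
- exact: Lrbar.
Qed.

Lemma free_obs k l (j : 'I_4) : (1 < j)%N -> free (inr j) (fun w => z k w l 0).
Proof.
move=> j1; rewrite /free_of; under eq_fun do rewrite zE.
have j0 : s_nbar != inr j by apply: contraTneq j1 => -[<-].
have j1' : s_rbar != inr j by apply: contraTneq j1 => -[<-].
apply: free_ofD; first apply: free_ofD; first exact: free_chan.
  apply: free_ofM; first exact: free_of_cst.
  exact: (@free_of_coord _ _ _ _ _ src _ s_nbar).
apply: free_ofM; last exact: (@free_of_coord _ _ _ _ _ src _ s_rbar).
by apply: free_ofM; [exact: free_of_cst|exact: free_amp].
Qed.

Section Combining.
Variables (k : 'I_K) (A : 'M[R[i]]_M).

Let v w := A *m z k w.

Lemma combineE w m : v w m 0 = \sum_l A m l * z k w l 0.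
Proof. by rewrite mxE. Qed.

Let L4v m : cLp P 4 (fun w => v w m 0).
Proof.
under eq_fun do rewrite combineE.
by apply: cLp_sum => l; apply: cLpZ; exact: cLp4_obs.
Qed.

Let free_v (j : 'I_4) m : (1 < j)%N -> free (inr j) (fun w => v w m 0).
Proof.
move=> j1; rewrite /free_of; under eq_fun do rewrite combineE.
apply: free_of_sum => l; apply: free_ofM; first exact: free_of_cst.
exact: free_obs.
Qed.

Lemma hdotE (x y : 'cV[R[i]]_M) : hdot x y = \sum_m (x m 0)^* * y m 0.
Proof. by rewrite /hdot mxE; apply: eq_bigr => m _; rewrite !mxE. Qed.

Lemma energy_data_noise :
  energy (fun w => hdot (v w) (n w)) =
  sigma2%:C * \sum_m energy (fun w => v w m 0).
Proof.
have := energy_noise_add mX indep (s := s_n) sigma2_ge0 n_CN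
  (free_of_cst src s_n 0) (fun m => free_of_conj (@free_v (@Ordinal 4 2 isT) m isT))
  (cLp_cst P 2 0) (fun m => cLp_conj (@cLpW _ _ _ _ 2 _ (L4v m))).
rewrite (_ : E (fun=> 0 * 0^*) = 0); last first.
  by rewrite -[RHS](cexpectation_cst P); apply: eq_cexpectation => w; rewrite mul0r.
rewrite add0r => E1.
rewrite (eq_bigr (fun m => energy (fun w => (v w m 0)^*))); last first.
  by move=> m _; rewrite energy_conj.
rewrite -[RHS]E1; apply: eq_cexpectation => w; rewrite add0r.
by rewrite hdotE.
Qed.

Lemma energy_data_distortion :
  energy (fun w => hdot (v w) (distortion eps rho (fun i => h i w) (r w))) =
  \sum_m (eps m)%:C ^+ 2 * \sum_i (rho i)%:C * energy (fun w => v w m 0 * h i w m 0).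
Proof.
pose W m w := (eps m)%:C * ((v w m 0)^* * amp rho m w).
have free_W m : free s_r (W m).
  apply: free_ofM; first exact: free_of_cst.
  by apply: free_ofM; [apply: free_of_conj; exact: free_v|exact: free_amp].
have L2 m : cLp P 2 (fun w => (v w m 0)^* * amp rho m w).
  by apply: cLpM; [exact: cLp_conj|exact: cLp4_amp].
have := energy_noise_add mX indep (s := s_r) ler01 r_CN'
  (free_of_cst src s_r 0) free_W (cLp_cst P 2 0) (fun m => cLpZ _ (L2 m)).
rewrite (_ : E (fun=> 0 * 0^*) = 0); last first.
  by rewrite -[RHS](cexpectation_cst P); apply: eq_cexpectation => w; rewrite mul0r.
rewrite add0r mul1r => E1.
transitivity (\sum_m energy (W m)).
  rewrite -[RHS]E1; apply: eq_cexpectation => w; rewrite add0r.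
  rewrite hdotE; congr (_ * _^*); apply: eq_bigr => m _;
    by rewrite (@distortionE rho (fun i => h i w) _ _ w)// /W; ring.
apply: eq_bigr => m _; rewrite energyZ// conj_realc -expr2.
congr (_ * _); rewrite energy_amp_mul//; last exact: cLp_conj.
apply: eq_bigr => i _; congr (_ * _); rewrite /energy.
by apply: eq_cexpectation => w; rewrite !rmorphM/= conjCK; ring.
Qed.

End Combining.

(** * Energies for an arbitrary combining matrix *)

Section CombiningMoments.
Variables (k : 'I_K) (A : 'M[R[i]]_M).

Local Notation Psi := (Psi tau pil sigma2 eps Rc).
Local Notation kappa := (((tau%:R * pil k)^-1)%:C : R[i]).
Local Notation Ah := (A^t* ).
Let v w := A *m z k w.

Let herm i : (Rc i)^t* = Rc i. Proof. exact: hermitian_trmxC. Qed.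

Let coord_row (x : 'cV[R[i]]_M) m : x m 0 = lin (row m 1%:M) x.
Proof. by rewrite /lin row1 -rowE mxE. Qed.

Let energy_chan j l : energy (fun w => h j w l 0) = Rc j l l.
Proof.
transitivity (cov (Rc j) (row l 1%:M) (row l 1%:M)).
  rewrite -(cexpectation_chan2 j).
  by apply: eq_cexpectation => w; rewrite !coord_row.
by rewrite cov_row trmxC1 mul1mx mulmx1.
Qed.

(* The excess [x j l] collects what the fourth moments add to the product of
   second moments in [energy_obs]; the rest is absorbed by [Psi]. *)
Let energy_obs_excess (b : 'I_M -> T -> R[i]) (q : 'I_M -> R[i])
    (x : 'I_K -> 'I_M -> R[i]) :
  (forall l, free s_nbar (b l)) -> (forall l, free s_rbar (b l)) ->
  (forall l, cLp P 4 (b l)) ->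
  (forall l, energy (b l) = q l) ->
  (forall j l, energy (fun w => b l w * h j w l 0) = q l * Rc j l l + x j l) ->
  energy (fun w => \sum_l b l w * z k w l 0) =
  energy (fun w => \sum_l b l w * h k w l 0) +
  kappa * (\sum_l noise_level pil sigma2 eps Rc l * q l) +
  kappa * (\sum_l (eps l)%:C ^+ 2 * \sum_j (pil j)%:C * x j l).
Proof.
move=> f0 f1 L4 bq bx; rewrite energy_obs// -addrA -mulrDr; congr (_ + _ * _).
rewrite mulr_sumr -!big_split/=; apply: eq_bigr => l _; rewrite bq.
rewrite (eq_bigr (fun j => (pil j)%:C * Rc j l l * q l + (pil j)%:C * x j l)).
  rewrite big_split/= -mulr_suml /noise_level mulrDl mulrDr !addrA; congr (_ + _ + _).
  rewrite mulrA mulr_sumr; congr (_ * _).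
  by apply: eq_bigr => j _; rewrite mulrCA.
by move=> j _; rewrite bx; ring.
Qed.

(** Deterministic weights produce no excess, so [Psi k] acts as the covariance of the pilot
    observation. *)
Lemma energy_combine m : energy (fun w => v w m 0) = (A *m Psi k *m Ah) m m.
Proof.
rewrite (eq_energy (combineE k A ^~ m)).
rewrite (@energy_obs_excess (fun l _ => A m l) (fun l => A m l * (A m l)^*)
  (fun _ _ => 0)); first last.
- move=> j l; rewrite addr0 energyZ; last exact: (@cLpW _ _ _ _ 2 _ (cLp4_chan _ _)).
  by rewrite energy_chan.
- by move=> l; rewrite /energy cexpectation_cst.
- by move=> l; exact: cLp_cst.
- by move=> l; exact: free_of_cst.
- by move=> l; exact: free_of_cst.
rewrite (big1 _ _ (fun l => (eps l)%:C ^+ 2 * _)) ?mulr0 ?addr0; last first.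
  by move=> l _; rewrite big1 ?mulr0// => j _; rewrite mulr0.
rewrite Psi_entry; congr (_ + _ * _).
  rewrite -cov_row -(cexpectation_chan2 k); apply: eq_cexpectation => w.
  by rewrite !linE; congr (_ * _^*); apply: eq_bigr => l _; rewrite mxE.
by apply: eq_bigr => l _; rewrite !mxE.
Qed.

(** Conjugating leaves the observation unconjugated and moves the channel into the weights, which is
    the shape that [energy_obs] handles. *)
Lemma hdot_conjE w x : (hdot (v w) x)^* =
  \sum_l (lin (row l Ah) x)^* * z k w l 0.
Proof.
rewrite hdotE rmorph_sum; under eq_bigr do rewrite rmorphM/= conjCK combineE mulr_suml.
rewrite exchange_big; apply: eq_bigr => l _.
rewrite linE rmorph_sum mulr_suml; apply: eq_bigr => m _.
by rewrite rmorphM/= !mxE conjCK; ring.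
Qed.

Let b i l w := (lin (row l Ah) (h i w))^*.

Let L4b i l : cLp P 4 (b i l).
Proof. by apply: cLp_conj; exact: cLp4_lin (Rc_psd i) (h_CN i) _. Qed.

Let free_b i l j : free (inr j) (b i l).
Proof. by apply: free_of_conj; exact: (@free_of_lin _ _ _ _ _ src _ (inl i)). Qed.

Lemma cexpectation_signal :
  E (fun w => hdot (v w) (h k w)) = (\tr (Rc k *m A))^*.
Proof.
apply: (can_inj conjCK); rewrite conjCK -cexpectation_conj; last first.
  have L1 : cLp P 1 (fun w => (hdot (v w) (h k w))^*).
    rewrite (_ : (fun w => _) = (fun w => \sum_l b k l w * z k w l 0)); last first.
      by apply/funext => w; exact: hdot_conjE.
    apply: cLp_sum => l; apply: cLpM; apply: (@cLpW _ _ _ _ 2); first exact: L4b.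
    exact: cLp4_obs.
  have := cLp_conj L1; by under eq_fun do rewrite conjCK.
rewrite (eq_cexpectation P (g := fun w => \sum_l b k l w * z k w l 0)); last first.
  by move=> w; exact: hdot_conjE.
rewrite (cexpectation_obs k (free_b k ^~ _) (free_b k ^~ _) (L4b k)).
rewrite cexpectation_sum; last first.
  move=> l; apply: cLpM; apply: (@cLpW _ _ _ _ 2); first exact: L4b.
  exact: cLp4_chan.
apply: eq_bigr => l _; rewrite -[A in RHS]trmxCK -[X in X *m _](mul1mx (Rc k)).
rewrite -cov_row -(cexpectation_chan2 k); apply: eq_cexpectation => w.
by rewrite coord_row mulrC.
Qed.

(** Two Gaussian pairings add to the product of second moments: h_k inside the observation meets h_i
    when [i = k], and the share of user j in the pilot distortion power meets h_i when [j = i]. *)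
Lemma energy_cross i :
  energy (fun w => hdot (v w) (h i w)) =
  \tr (Psi k *m (Ah *m Rc i *m A)) +
  (i == k)%:R * (\tr (Rc k *m A) * \tr (Ah *m Rc k)) +
  kappa * (\sum_l (eps l)%:C ^+ 2 *
    ((pil i)%:C * ((Rc i *m A) l l * (Ah *m Rc i) l l))).
Proof.
rewrite -energy_conj (eq_energy (fun w => hdot_conjE w (h i w))).
rewrite (@energy_obs_excess (b i) (fun l => (Ah *m Rc i *m A) l l)
  (fun j l => (i == j)%:R * ((Rc i *m A) l l * (Ah *m Rc i) l l))
  (free_b i ^~ _) (free_b i ^~ _) (L4b i)); last 2 first.
- move=> l; rewrite energy_conj /energy cexpectation_chan2 cov_row.
  by rewrite trmxCK.
- move=> j l; rewrite /energy.
  rewrite (eq_cexpectation P (g := fun w => lin (row l 1%:M) (h j w) * (lin (row l 1%:M) (h j w))^* *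
      (lin (row l Ah) (h i w) * (lin (row l Ah) (h i w))^*))); last first.
    by move=> w; rewrite /b rmorphM/= conjCK !coord_row; ring.
  rewrite cexpectation_chan4 !cov_row trmxC1 !mul1mx !mulmx1 trmxCK.
  by rewrite mulrC.
rewrite tr_Psi; congr (_ + _); last first.
  congr (_ * _); apply: eq_bigr => l _; congr (_ * _).
  rewrite (bigD1 i)//= eqxx mul1r big1 ?addr0// => j ji.
  by rewrite eq_sym (negbTE ji) mul0r mulr0.
rewrite addrAC; congr (_ + _).
transitivity (E (fun w => \sum_l \sum_m
    (lin (row l 1%:M) (h k w) * (lin (row m 1%:M) (h k w))^* *
    (lin (row m Ah) (h i w) * (lin (row l Ah) (h i w))^*)))).
  apply: eq_cexpectation => w; rewrite mulr_suml; apply: eq_bigr => l _.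
  rewrite rmorph_sum mulr_sumr; apply: eq_bigr => m _.
  by rewrite rmorphM/= /b conjCK !coord_row; ring.
have L l m : cLp P 1 (fun w =>
    lin (row l 1%:M) (h k w) * (lin (row m 1%:M) (h k w))^* *
    (lin (row m Ah) (h i w) * (lin (row l Ah) (h i w))^*)).
  apply: cLpM; first exact: (cLp2_lin2 (Rc_psd k) (h_CN k)).
  exact: (cLp2_lin2 (Rc_psd i) (h_CN i)).
rewrite cexpectation_sum; last by move=> l; exact: cLp_sum.
rewrite (eq_bigr (fun l => (Rc k *m (Ah *m Rc i *m A)) l l +
    (i == k)%:R * ((Rc i *m A) l l * \tr (Ah *m Rc i)))); last first.
  move=> l _; rewrite cexpectation_sum//.
  under eq_bigr do rewrite cexpectation_chan4 !cov_row trmxC1 !mul1mx !mulmx1 trmxCK.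
  by rewrite big_split/= -!mulr_sumr [in RHS]mxE.
rewrite big_split/=; congr (_ + _).
have [->|_] := eqVneq i k; last by rewrite mul0r big1// => l _; rewrite mul0r.
by rewrite mul1r /mxtrace mulr_suml; apply: eq_bigr => l _; rewrite mul1r.
Qed.

(** The same two coincidences occur for the share of user i in the data distortion at antenna [m].
    The term with [i = k] becomes S_k; the sum scaled by [kappa] becomes the second half of T_k. *)
Lemma energy_coord_mul i m :
  energy (fun w => v w m 0 * h i w m 0) =
  (A *m Psi k *m Ah) m m * Rc i m m +
  (i == k)%:R * ((A *m Rc k) m m * (Rc k *m Ah) m m) +
  kappa * (\sum_l (eps l)%:C ^+ 2 *
    ((pil i)%:C * (A m l * (A m l)^* * (Rc i l m * Rc i m l)))).
Proof.
pose c' l w := A m l * lin (row m 1%:M) (h i w).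
have E1 w : v w m 0 * h i w m 0 = \sum_l c' l w * z k w l 0.
  rewrite combineE mulr_suml; apply: eq_bigr => l _.
  by rewrite /c' -coord_row; ring.
rewrite (eq_energy E1).
have Lm : cLp P 4 (fun w => lin (row m 1%:M) (h i w)).
  exact: cLp4_lin (Rc_psd i) (h_CN i) _.
have fm j : free (inr j) (fun w => lin (row m 1%:M) (h i w)).
  exact: (@free_of_lin _ _ _ _ _ src _ (inl i)).
rewrite (@energy_obs_excess c' (fun l => A m l * (A m l)^* * Rc i m m)
  (fun j l => (i == j)%:R * (A m l * (A m l)^* * (Rc i l m * Rc i m l)))); first last.
- move=> j l; rewrite /energy.
  rewrite (eq_cexpectation P (g := fun w => A m l * (A m l)^* *
     (lin (row l 1%:M) (h j w) * (lin (row l 1%:M) (h j w))^* *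
      (lin (row m 1%:M) (h i w) * (lin (row m 1%:M) (h i w))^*)))); last first.
    by move=> w; rewrite /c' !rmorphM/= (coord_row (h j w) l); ring.
  rewrite cexpectationZ; last first.
    apply: cLpM; first exact: (cLp2_lin2 (Rc_psd j) (h_CN j)).
    exact: (cLp2_lin2 (Rc_psd i) (h_CN i)).
  by rewrite cexpectation_chan4 !cov_row trmxC1 !mul1mx !mulmx1; ring.
- move=> l; rewrite energyZ; last exact: (@cLpW _ _ _ _ 2).
  by rewrite /energy cexpectation_chan2 cov_row trmxC1 mul1mx mulmx1.
- by move=> l; exact: cLpZ.
- by move=> l; apply: free_ofM; [exact: free_of_cst|exact: fm].
- by move=> l; apply: free_ofM; [exact: free_of_cst|exact: fm].
congr (_ + _ * _); last first.
  apply: eq_bigr => l _; congr (_ * _).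
  rewrite (bigD1 i)//= eqxx mul1r big1 ?addr0// => j ji.
  by rewrite eq_sym (negbTE ji) mul0r mulr0.
rewrite Psi_entry mulrDl [RHS]addrAC; congr (_ + _); last first.
  rewrite -mulrA mulr_suml; congr (_ * _); apply: eq_bigr => l _.
  by rewrite !mxE mulrA.
rewrite /energy (eq_cexpectation P (g := fun w =>
    lin (row m A) (h k w) * (lin (row m A) (h k w))^* *
    (lin (row m 1%:M) (h i w) * (lin (row m 1%:M) (h i w))^*))); last first.
  move=> w; have -> : \sum_l c' l w * h k w l 0 =
      lin (row m A) (h k w) * lin (row m 1%:M) (h i w).
    by rewrite [lin (row m A) _]linE mulr_suml; apply: eq_bigr => l _;
      rewrite /c' mxE; ring.
  by rewrite rmorphM/= mulrACA.
rewrite cexpectation_chan4 !cov_row trmxC1 !mul1mx !mulmx1.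
by case: eqP => [->|]; rewrite ?mul0r.
Qed.

End CombiningMoments.

(** * The LMMSE filter and the closed form *)

Section EffectiveSINR.
Hypotheses (tau_gt0 : (0 < tau)%N) (pil_gt0 : forall i, 0 < pil i).
Hypotheses (sigma2_gt0 : 0 < sigma2) (eps_ge0 : forall m, 0 <= eps m).
Variable k : 'I_K.

Local Notation Psi := (Psi tau pil sigma2 eps Rc).
Local Notation kappa := (((tau%:R * pil k)^-1)%:C : R[i]).
Local Notation A := (Rc k *m invmx (Psi k)).
Local Notation Ah := (A^t* ).
Local Notation Q := (Rc k *m invmx (Psi k) *m Rc k).
Let e2 m : R[i] := (eps m)%:C ^+ 2.
Let tauQ : R[i] := \tr Q.
Let v w := lmmse tau pil sigma2 eps Rc k (z k w).

Let herm i : (Rc i)^t* = Rc i. Proof. exact: hermitian_trmxC. Qed.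

Let uPsi : Psi k \in unitmx. Proof. exact: Psi_unit. Qed.

Let AhE : Ah = invmx (Psi k) *m Rc k.
Proof. by rewrite map_trmx_mul herm trmx_inv map_invmx Psi_trmxC. Qed.

Let RAh : Rc k *m Ah = Q. Proof. by rewrite AhE mulmxA. Qed.

(** The cancellation special to the LMMSE filter: the covariance of the estimate equals its
    cross-covariance with the channel, as [RAh] shows, so one matrix [Q] appears throughout. *)
Let APsiAh : A *m Psi k *m Ah = Q.
Proof. by rewrite mulmxKV// RAh. Qed.

Let Q_herm : Q^t* = Q.
Proof. by rewrite map_trmx_mul herm RAh. Qed.

Let Q_diag m : (Q m m)^* = Q m m. Proof. exact: hermitian_entry. Qed.

Let tauQ_conj : tauQ^* = tauQ.
Proof. by rewrite /tauQ rmorph_sum/=; apply: eq_bigr => m _; exact: Q_diag. Qed.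

Let tr_Rc_A : \tr (Rc k *m A) = tauQ. Proof. exact: mxtrace_mulC. Qed.

Let tr_Ah_Rc : \tr (Ah *m Rc k) = tauQ.
Proof. by rewrite mxtrace_mulC RAh. Qed.

(** Cyclicity brings [A] next to [Psi k], where the inverse cancels and leaves [Rc k], and then
    [Rc k] next to [Ah], which gives [Q]. *)
Let tr_Psi_cross i : \tr (Psi k *m (Ah *m Rc i *m A)) = \tr (Rc i *m Q).
Proof.
rewrite mxtrace_mulC -[_ *m A *m _]mulmxA mulmxKV// mxtrace_mulC.
by rewrite (mulmxA (Rc k) Ah) RAh mxtrace_mulC.
Qed.

Let signal_eq :
  (normc (E (fun w => hdot (v w) (h k w))) ^+ 2 * rho k)%:C =
  (rho k)%:C * tauQ ^+ 2.
Proof.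
transitivity ((normc (E (fun w => hdot (v w) (h k w))) ^+ 2)%:C * (rho k)%:C).
  exact: rmorphM.
rewrite -mul_conj_normc (_ : E _ = tauQ); last by rewrite -tauQ_conj -tr_Rc_A -cexpectation_signal.
by rewrite tauQ_conj mulrC expr2.
Qed.

Let noise_eq : (second_moment P (fun w => hdot (v w) (n w)))%:C = sigma2%:C * tauQ.
Proof.
rewrite second_momentE [LHS](energy_data_noise k A); congr (_ * _).
by apply: eq_bigr => m _; rewrite energy_combine APsiAh.
Qed.

(** Antenna-wise forms of the traces: [G] and [H] are the two halves of T_k, [V] is the distortion
    part of U_k, and [S] is S_k without its factor rho_k. *)
Let G i : R[i] := \sum_l e2 l * ((Rc i *m A) l l * ((Rc i *m A) l l)^*).
Let H i : R[i] := \sum_m e2 m * \sum_l A m l * (A m l)^* * e2 l *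
  (Rc i l m * (Rc i l m)^*).
Let V i : R[i] := \sum_m e2 m * (Rc i m m * Q m m).
Let S : R[i] := \sum_m e2 m * (Q m m * (Q m m)^*).

Let cross_eq :
  (\sum_(i < K) second_moment P (fun w => hdot (v w) (h i w)) * rho i)%:C =
  \sum_i (rho i)%:C * \tr (Rc i *m Q) + (rho k)%:C * tauQ ^+ 2 +
  \sum_i (rho i * pil i / (tau%:R * pil k))%:C * G i.
Proof.
rewrite rmorph_sum/=.
rewrite (eq_bigr (fun i => (rho i)%:C * \tr (Rc i *m Q) +
    (i == k)%:R * ((rho i)%:C * tauQ ^+ 2) +
    (rho i * pil i / (tau%:R * pil k))%:C * G i)); last first.
  move=> i _; rewrite rmorphM/= second_momentE.
  rewrite [X in X * _](energy_cross k A i) tr_Psi_cross tr_Rc_A tr_Ah_Rc.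
  rewrite (eq_bigr (fun l => (pil i)%:C *
      (e2 l * ((Rc i *m A) l l * ((Rc i *m A) l l)^*)))); last first.
    move=> l _; rewrite mulrCA; congr (_ * (_ * (_ * _))).
    by rewrite -trmxC_entry (map_trmx_mul (Rc i) A) herm.
  rewrite -mulr_sumr -/(G i) !rmorphM/=; ring.
rewrite !big_split/=; congr (_ + _ + _).
rewrite (bigD1 k)//= eqxx mul1r big1 ?addr0// => i ik.
by rewrite (negbTE ik) mul0r.
Qed.

Let distortion_eq :
  (second_moment P (fun w =>
     hdot (v w) (distortion eps rho (fun i => h i w) (r w))))%:C =
  \sum_i (rho i)%:C * V i + (rho k)%:C * S +
  \sum_i (rho i * pil i / (tau%:R * pil k))%:C * H i.
Proof.
rewrite second_momentE [LHS](energy_data_distortion k A).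
rewrite (eq_bigr (fun m => \sum_i (
    (rho i)%:C * (e2 m * (Rc i m m * Q m m)) +
    (i == k)%:R * ((rho i)%:C * (e2 m * (Q m m * (Q m m)^*))) +
    (rho i * pil i / (tau%:R * pil k))%:C * (e2 m * \sum_l A m l * (A m l)^* * e2 l *
      (Rc i l m * (Rc i l m)^*))))); last first.
  move=> m _; rewrite mulr_sumr; apply: eq_bigr => i _.
  rewrite energy_coord_mul APsiAh RAh Q_diag.
  rewrite (eq_bigr (fun l => (pil i)%:C * (A m l * (A m l)^* * e2 l *
      (Rc i l m * (Rc i l m)^*)))); last first.
    by move=> l _; rewrite (hermitian_entry l m (herm i)) -/(e2 l); ring.
  by rewrite -mulr_sumr -/(e2 m) !rmorphM/=; ring.
rewrite exchange_big/=.
under eq_bigr do rewrite !big_split/= -!mulr_sumr.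
rewrite !big_split/=; congr (_ + _ + _).
rewrite -/S (bigD1 k)//= eqxx mul1r big1 ?addr0// => i ik.
by rewrite (negbTE ik) mul0r.
Qed.

Let S_termE : S_term tau pil rho sigma2 eps Rc k = (rho k)%:C * S.
Proof.
rewrite /S_term tr_Deps2; congr (_ * _); apply: eq_bigr => m _.
by rewrite abs2mx_diagpart.
Qed.

Let T_termE : T_term tau pil rho sigma2 eps Rc k =
  \sum_i (rho i * pil i / (tau%:R * pil k))%:C * G i +
  \sum_i (rho i * pil i / (tau%:R * pil k))%:C * H i.
Proof.
rewrite /T_term -big_split/=; apply: eq_bigr => i _; rewrite -[in RHS]mulrDr; congr (_ * _).
rewrite mxtraceD !tr_Deps2; congr (_ + _); apply: eq_bigr => m _; congr (_ * _).
  by rewrite abs2mx_diagpart mulmxA.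
rewrite mxE eqxx mulr1n mxE expr2 -mulmxE /Deps mulmx_diag mul_mx_diag mxE.
by apply: eq_bigr => l _; rewrite !mxE -expr2 !normCK.
Qed.

Let U_termE : U_term tau pil rho sigma2 eps Rc k =
  \sum_i (rho i)%:C * \tr (Rc i *m Q) + sigma2%:C * tauQ +
  \sum_i (rho i)%:C * V i.
Proof.
rewrite /U_term !mulmxDl !mxtraceD mul_scalar_mx mxtraceZ; congr (_ + _ + _).
  rewrite mulmx_suml raddf_sum/=; apply: eq_bigr => i _.
  by rewrite -scalemxAl mxtraceZ.
rewrite mulmx_suml raddf_sum/=; apply: eq_bigr => i _.
rewrite -scalemxAl mxtraceZ -mulmxA tr_Deps2; congr (_ * _).
apply: eq_bigr => m _; congr (_ * _).
by rewrite /diagpart mul_diag_mx !mxE.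
Qed.

Lemma SINR_lmmse_mrc :
  (SINR P rho h n
     (fun w => distortion eps rho (fun i => h i w) (r w)) v k)%:C =
  SINR_mrc tau pil rho sigma2 eps Rc k.
Proof.
have divC (x y : R) : (x / y)%:C = x%:C / y%:C :> R[i] by rewrite fmorph_div.
have sumC (x y t u : R) : (x - y + t + u)%:C = x%:C - y%:C + t%:C + u%:C :> R[i].
  by rewrite !rmorphD rmorphN.
(* The summand [(rho k)%:C * tauQ ^+ 2] of [cross_eq] cancels the subtracted signal; the remaining
   terms are those of S_k, T_k and U_k in another order. *)
rewrite [LHS]divC sumC signal_eq cross_eq noise_eq distortion_eq.
rewrite /SINR_mrc S_termE T_termE U_termE; congr (_ / _); ring.
Qed.

End EffectiveSINR.

End UplinkMoments.

Local Open Scope complex_scope.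

Theorem corollary1
  (R : realType) (d : measure_display) (T : measurableType d)
  (P : probability T R)
  (M K : nat)
  (tau : nat) (pil rho : 'I_K -> R) (sigma2 : R) (eps : 'I_M -> R)
  (Rc : 'I_K -> 'M[R[i]]_M)
  (h : 'I_K -> T -> 'cV[R[i]]_M) (nbar rbar n r : T -> 'cV[R[i]]_M)
  (tau_gt0 : (0 < tau)%N)
  (pil_gt0 : forall i, 0 < pil i)
  (rho_ge0 : forall i, 0 <= rho i)
  (sigma2_gt0 : 0 < sigma2)
  (eps_ge0 : forall m, 0 <= eps m)
  (Rc_psd : forall i, hermitian_psd (Rc i))
  (Rc_neq0 : forall i, Rc i != 0)
  (h_CN : forall i, is_CN P (Rc i) (h i))
  (nbar_CN : is_CN P sigma2%:C%:M nbar)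
  (rbar_CN : is_CN P 1%:M rbar)
  (n_CN : is_CN P sigma2%:C%:M n)
  (r_CN : is_CN P 1%:M r)
  (indep : mutually_independent P (sources h nbar rbar n r)) :
  let H := fun w i => h i w in
  let z := fun k w => pilot_obs tau pil eps (H w) (nbar w) (rbar w) k in
  let hhat := fun k w => lmmse tau pil sigma2 eps Rc k (z k w) in
  let e := fun w => distortion eps rho (H w) (r w) in
  forall k : 'I_K,
    (SINR P rho h n e (hhat k) k)%:C = SINR_mrc tau pil rho sigma2 eps Rc k.
Proof.
move=> H z hhat e k.
have pil_ge0 i : 0 <= pil i by exact/ltW.
have sigma2_ge0 := ltW sigma2_gt0.
exact: (SINR_lmmse_mrc pil_ge0 rho_ge0 sigma2_ge0 Rc_psd h_CN nbar_CN rbar_CN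
  n_CN r_CN indep).
Qed.
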